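(* Let $(M,\omega,\mathbb{T},\psi)$ be a symplectic toric manifold, together with a choice of a generic component of the moment map $\mu=\langle\psi,\overline{\xi}\rangle\colon M\to\mathbb{R}$, not necessarily index increasing. Then for each $p\in M^{\mathbb{T}}$ the (equivariant cohomology) i-canonical class $\tau_p\in H_{\mathbb{T}}^*(M;\mathbb{Z})$ exists, and is equal to the equivariant Poincaré dual $\eta_p$ to the flow-up submanifold $F_p$.
   Context: Setting. A symplectic toric manifold $(M,\omega,\mathbb{T},\psi)$ of dimension $2n$ is a compact connected symplectic manifold $(M^{2n},\omega)$ with an effective Hamiltonian action of an $n$-dimensional torus $\mathbb{T}$ with Lie algebra $\mathfrak{t}$ and moment map $\psi\colon M\to\mathfrak{t}^*$ ($\mathbb{T}$-invariant, $\iota_{\xi^\#}\omega=-d\langle\psi,\xi\rangle$ for $\xi\in\mathfrak{t}$). The fixed point set $M^{\mathbb{T}}$ is discrete. Let $\ell^*\subset\mathfrak{t}^*$ be the weight lattice; $w\in\ell^*$ corresponds to the character $\exp(\xi)\mapsto e^{2\pi i w(\xi)}$. Let $J$ be a $\mathbb{T}$-invariant almost complex structure such that $\omega(J\cdot,\cdot)$ is an inner product; for $p\in M^{\mathbb{T}}$ let $W_p$ be the set of weights of the isotropy representation of $\mathbb{T}$ on $(T_pM,J)\simeq\mathbb{C}^n$; it is a $\mathbb{Z}$-basis of $\ell^*$. Generic component. $\overline{\xi}\in\mathfrak{t}$ is generic if $w(\overline{\xi})\ne0$ for all isotropy weights $w\in\bigcup_pW_p$ and $\mu=\langle\psi,\overline{\xi}\rangle$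 takes distinct values at distinct fixed points; then $\mu$ is called a generic component of the moment map. Put $W_p^{\pm}=\{w\in W_p:\pm w(\overline{\xi})>0\}$ and $\lambda_p=|W_p^+|$. With these conventions $W_p^+$ is the set of weights on the negative normal bundle of the Morse function $\mu$ at $p$. ($\mu$ is index increasing if $\lambda_r<\lambda_q$ whenever $r,q\in M^{\mathbb{T}}$ are joined by an edge of $\psi(M)$ and $\mu(r)<\mu(q)$; this is not assumed.) GKM graph. $\Gamma=(V,E)$ has $V=M^{\mathbb{T}}$ (identified with the vertices of the polytope $\psi(M)$) and a directed edge $\overrightarrow{r\,q}$ in each direction for every edge of $\psi(M)$; $w(\overrightarrow{r\,q})\in\ell^*$ is the weight of $\mathbb{T}$ on the tangent space at $q$ of the invariant sphere over that edge, equivalently the primitive element of $\ell^*$ with $\psi(q)-\psi(r)=m\,w(\overrightarrow{r\,q})$, $m>0$. Flow-up. $F_p=\psi^{-1}\big((\psi(p)+\mathrm{span}_{\mathbb{R}}W_p^-)\cap\psi(M)\big)$, a closed $\mathbb{T}$-invariant symplectic submanifold of dimension $2(n-\lambda_p)$. Equivariant cohomology. $H^*_{\mathbb{T}}(M;\mathbb{Z})=H^*(M\times_{\mathbb{T}}E\mathbb{T};\mathbb{Z})$, a module over $H^*_{\mathbb{T}}(\mathrm{pt};\mathbb{Z})=\mathbb{Z}[x_1,\dots,x_n]$, the integral symmetric algebra of $\ell^*$ ($x_1,\dots,x_n$ a $\mathbb{Z}$-basis of $\ell^*$, in degree $2$). For $\tau\in H^*_{\mathbb{T}}(M;\mathbb{Z})$,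 $\tau(p)\in H^*_{\mathbb{T}}(\mathrm{pt};\mathbb{Z})$ is its restriction to $p\in M^{\mathbb{T}}$; restriction to $M^{\mathbb{T}}$ is injective. Poincaré dual. $\eta_p\in H^{2\lambda_p}_{\mathbb{T}}(M;\mathbb{Z})$ is the class with $\eta_p(q)=0$ for $q\in M^{\mathbb{T}}\setminus F_p$ and $\eta_p(q)=\prod_{r\in M^{\mathbb{T}}\setminus F_p,\ \overrightarrow{r\,q}\in E}w(\overrightarrow{r\,q})$ for $q\in F_p\cap M^{\mathbb{T}}$ (the equivariant Euler class of the normal bundle of $F_p$ at $q$). Kirwan class. $\nu\in H^*_{\mathbb{T}}(M;\mathbb{Z})$ is a Kirwan class at $p$ if $\nu(p)=\Lambda_p^-:=\prod_{w\in W_p^+}w$ and $\nu(q)=0$ for every $q\in M^{\mathbb{T}}$ with $\mu(q)<\mu(p)$. Local index. Let $q\in M^{\mathbb{T}}$, $\lambda=\lambda_q$, $W_q^+=\{w_1,\dots,w_\lambda\}$, $W_q^-=\{w_{\lambda+1},\dots,w_n\}$. Let $w_0$ be a further generator, so that $w_0,w_1,\dots,w_n$ is a $\mathbb{Z}$-basis of the weight lattice of $\mathbb{T}\times S^1$. Given $\tau\in H^*_{\mathbb{T}}(M;\mathbb{Z})$ write $\tau(q)=f(w_1,\dots,w_n)$ with $f$ a polynomial with integer coefficients, and put $$f_0=f(w_0+w_1,\dots,w_0+w_\lambda,w_{\lambda+1},\dots,w_n),$$ $$f_j=f(w_1-w_j,\dots,w_\lambda-w_j,w_{\lambda+1},\dots,w_n),\quad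 1\le j\le\lambda.$$ These are the fixed-point restrictions of a class in the equivariant cohomology of $\mathbb{C}\mathbb{P}^{\lambda}$, where the torus acts with isotropy weights $\{w_0+w_k\}_{1\le k\le\lambda}$ at the $0$-th fixed point and $\{-(w_j+w_0)\}\cup\{w_k-w_j\}_{1\le k\le\lambda,\,k\ne j}$ at the $j$-th. The local index $\mathrm{Ind}_q(\tau)\in H_{\mathbb{T}}^*(\mathrm{pt};\mathbb{Z})$ is the image, under the ring homomorphism sending $w_0$ to $0$ and fixing $w_1,\dots,w_n$, of the integral of this class over $\mathbb{C}\mathbb{P}^{\lambda}$, i.e. of $$\frac{f_0}{\prod_{k=1}^{\lambda}(w_k+w_0)}+\sum_{j=1}^{\lambda}\frac{f_j}{(-w_j-w_0)\prod_{1\le k\le\lambda,\,k\neq j}(w_k-w_j)},$$ which is a polynomial. (If $\lambda=0$ then $\mathrm{Ind}_q(\tau)=\tau(q)$.) i-canonical class. An i-canonical class at $p$ is a Kirwan class $\tau_p\in H^*_{\mathbb{T}}(M;\mathbb{Z})$ at $p$ with $\mathrm{Ind}_p(\tau_p)=1$ and $\mathrm{Ind}_q(\tau_p)=0$ for all $q\in M^{\mathbb{T}}\setminus\{p\}$; it is unique if it exists. *)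

(* Defs.v *)
From HB Require Import structures.
From mathcomp Require Import all_boot all_order all_algebra fraction finmap.
From mathcomp Require Import all_classical all_reals all_analysis ring.
From mathcomp Require mpoly.
(* only canonicals and coercions: the notations of mpoly clash with those of
   mathcomp-analysis *)
Import (canonicals, coercions) mpoly.

Set Implicit Arguments.
Unset Strict Implicit.
Unset Printing Implicit Defensive.

Import Order.TTheory GRing.Theory Num.Theory.
Import numFieldNormedType.Exports.
Local Open Scope classical_set_scope.
Local Open Scope quotient_scope.
Local Open Scope ring_scope.

Notation zpoly n := (mpoly.mpoly n int).

(** * Smooth maps and smooth manifolds *)

Section Calculus.
Variable R : realType.

Definition dotp n (u v : 'rV[R]_n) : R := \sum_(i < n) u 0 i * v 0 i.

Definition ddir m (f : 'rV[R]_m -> R) (v x : 'rV[R]_m) : R :=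
  derive1 (fun t : R => f (x + t *: v)) 0.

Definition pd m (i : 'I_m) (f : 'rV[R]_m -> R) : 'rV[R]_m -> R :=
  ddir f (delta_mx 0 i).

Fixpoint Ck m (U : set 'rV[R]_m) (k : nat) (f : 'rV[R]_m -> R) : Prop :=
  match k with
  | 0 => forall x, U x -> {for x, continuous f}
  | k'.+1 => forall i,
      (forall x, U x -> derivable (fun t : R => f (x + t *: delta_mx 0 i)) 0 1) /\
      Ck U k' (pd i f)
  end.

Definition smooth m (U : set 'rV[R]_m) (f : 'rV[R]_m -> R) : Prop :=
  forall k, Ck U k f.

Definition smooth_map m k (U : set 'rV[R]_m) (f : 'rV[R]_m -> 'rV[R]_k) : Prop :=
  forall j, smooth U (fun x => f x 0 j).

(* Tangent vectors are row vectors: the differential of f at x is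
   v |-> v *m jac f x. *)
Definition jac m k (f : 'rV[R]_m -> 'rV[R]_k) (x : 'rV[R]_m) : 'M[R]_(m, k) :=
  \matrix_(i, j) pd i (fun y => f y 0 j) x.

Record manifold (m : nat) := Manifold {
  points :> topologicalType;
  hausdorff_points : hausdorff_space points;
  second_countable_points : @second_countable points;
  chart : Type;
  dom : chart -> set points;
  coord : chart -> points -> 'rV[R]_m;
  param : chart -> 'rV[R]_m -> points;
  dom_open : forall a, open (dom a);
  dom_cover : forall p, exists a, dom a p;
  cod_open : forall a, open (coord a @` dom a);
  coordK : forall a p, dom a p -> param a (coord a p) = p;
  coord_continuous : forall a p, dom a p -> {for p, continuous (coord a)};
  param_continuous : forall a y, (coord a @` dom a) y ->
    {for y, continuous (param a)};
  transition_smooth : forall a b,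
    smooth_map ((coord a @` dom a) `&` (param a @^-1` dom b))
               (fun y => coord b (param a y))
}.

Definition cod m (M : manifold m) (a : chart M) : set 'rV[R]_m :=
  coord a @` dom a.

End Calculus.

(** * Symplectic toric manifolds *)

Section Toric.
Variables (R : realType) (n : nat).

(* The Lie algebra of the torus is 'rV[R]_n, the kernel of exp is the set of
   integral vectors, and act s is the action of exp(s).  The dual of the Lie
   algebra is 'rV[R]_n through dotp, and the weight lattice is 'rV[int]_n. *)
Definition integral (s : 'rV[R]_n) : Prop := forall i, s 0 i \is a Num.int.

Record symplectic_toric := SymplecticToric {
  mfd :> manifold R n.*2;
  compact_mfd : compact [set: mfd];
  connected_mfd : connected [set: mfd];
  (* symplectic form: its Gram matrices in the charts *)
  omega : chart mfd -> 'rV[R]_n.*2 -> 'M[R]_n.*2;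
  omega_smooth : forall a i j, smooth (cod a) (fun y => omega a y i j);
  omega_alternating : forall a y, cod a y -> (omega a y)^T = - omega a y;
  omega_nondegenerate : forall a y, cod a y -> omega a y \in unitmx;
  omega_closed : forall a y i j k, cod a y ->
    pd i (fun z => omega a z j k) y + pd j (fun z => omega a z k i) y
      + pd k (fun z => omega a z i j) y = 0;
  (* torus action *)
  act : 'rV[R]_n -> mfd -> mfd;
  act0 : forall p, act 0 p = p;
  actD : forall s t p, act (s + t) p = act s (act t p);
  act_effective : forall s, (forall p, act s p = p) <-> integral s;
  act_continuous : continuous (fun z : 'rV[R]_n * mfd => act z.1 z.2);
  act_smooth : forall a b,
    smooth_map [set z : 'rV[R]_(n + n.*2) | cod a (rsubmx z) /\
                  dom b (act (lsubmx z) (param a (rsubmx z)))]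
               (fun z => coord b (act (lsubmx z) (param a (rsubmx z))));
  (* the action is symplectic; for s = 0 this is the gluing of omega *)
  act_symplectic : forall a b s y, cod a y -> dom b (act s (param a y)) ->
    let g z := coord b (act s (param a z)) in
    omega a y = jac g y *m omega b (g y) *m (jac g y)^T;
  (* moment map *)
  psi : mfd -> 'rV[R]_n;
  psi_smooth : forall a, smooth_map (cod a) (fun y => psi (param a y));
  psi_invariant : forall s p, psi (act s p) = psi p;
  psi_moment : forall a y (xi : 'rV[R]_n) (v : 'rV[R]_n.*2), cod a y ->
    let xi_fund : 'rV[R]_n.*2 :=
      \row_j derive1 (fun t : R => coord a (act (t *: xi) (param a y)) 0 j) 0 in
    (xi_fund *m omega a y *m v^T) 0 0
      = - ddir (fun z => dotp (psi (param a z)) xi) v y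
}.

(* An almost complex structure on M, v |-> v *m J a y on tangent vectors. *)
Definition acs (M : symplectic_toric) : Type :=
  chart M -> 'rV[R]_n.*2 -> 'M[R]_n.*2.

(* Invariant almost complex structure J with omega(J.,.) an inner product. *)
Definition compatible_acs (M : symplectic_toric) (J : acs M) : Prop :=
  [/\ forall a i j, smooth (cod a) (fun y => J a y i j),
      forall a y, cod a y -> J a y *m J a y = - 1%:M,
      forall a b s y, cod a y -> dom b (act s (param a y)) ->
        let g z := coord b (act s (param a z)) in
        J a y *m jac g y = jac g y *m J b (g y),
      forall a y, cod a y -> (J a y *m omega a y)^T = J a y *m omega a y &
      forall a y (v : 'rV[R]_n.*2), cod a y -> v != 0 ->
        0 < (v *m J a y *m omega a y *m v^T) 0 0].

Definition fixed (M : symplectic_toric) (p : M) : Prop :=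
  forall s, act s p = p.

(** ** Weights *)

Definition wR (w : 'rV[int]_n) : 'rV[R]_n := map_mx intr w.

Definition weights (M : symplectic_toric) (J : acs M) (p : M) : set 'rV[int]_n :=
  [set w | exists a (v : 'rV[R]_n.*2), [/\ dom a p, v != 0 &
    forall s : 'rV[R]_n,
      let th := 2 * pi * dotp (wR w) s in
      v *m jac (fun z => coord a (act s (param a z))) (coord a p)
        = cos th *: v + sin th *: (v *m J a (coord a p))]].

Definition wplus (M : symplectic_toric) (J : acs M) (xi : 'rV[R]_n) (p : M) :=
  [set w | weights J p w /\ 0 < dotp (wR w) xi].

Definition wminus (M : symplectic_toric) (J : acs M) (xi : 'rV[R]_n) (p : M) :=
  [set w | weights J p w /\ dotp (wR w) xi < 0].

Definition lambda (M : symplectic_toric) (J : acs M) xi (p : M) : nat :=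
  #|` fset_set (wplus J xi p)|.

Definition mu (M : symplectic_toric) (xi : 'rV[R]_n) (p : M) : R :=
  dotp (psi p) xi.

Definition generic (M : symplectic_toric) (J : acs M) (xi : 'rV[R]_n) : Prop :=
  (forall (p : M) w, fixed p -> weights J p w -> dotp (wR w) xi != 0) /\
  (forall p q : M, fixed p -> fixed q -> mu xi p = mu xi q -> p = q).

(** ** Moment polytope, GKM graph, flow-up *)

Definition segment (u v : 'rV[R]_n) : set 'rV[R]_n :=
  [set y | exists t : R, [/\ 0 <= t, t <= 1 & y = (1 - t) *: u + t *: v]].

(* The subset F of P is cut out by a supporting hyperplane of P. *)
Definition face (P F : set 'rV[R]_n) : Prop :=
  exists (c : 'rV[R]_n) (b : R),
    (forall y, P y -> dotp c y <= b) /\ F = [set y | P y /\ dotp c y = b].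

Definition conv_hull (A : set 'rV[R]_n) : set 'rV[R]_n :=
  [set y | exists k (u : 'I_k -> 'rV[R]_n) (c : 'I_k -> R),
    [/\ forall i, A (u i) /\ 0 <= c i, \sum_i c i = 1
      & y = \sum_i c i *: u i]].

Definition edge (M : symplectic_toric) (r q : M) : Prop :=
  [/\ fixed r, fixed q, r != q
    & face (range (@psi M)) (segment (psi r) (psi q))].

Definition primitive (w : 'rV[int]_n) : Prop :=
  forall (d : int) u, w = d *: u -> d = 1 \/ d = -1.

Definition edge_weight (M : symplectic_toric) (r q : M) : 'rV[int]_n :=
  xget 0 [set w | primitive w /\
    exists2 m : R, 0 < m & psi q - psi r = m *: wR w].

Definition flow_up (M : symplectic_toric) (J : acs M) xi (p : M) : set M :=
  [set q | exists c : 'rV[int]_n -> R,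
    psi q = psi p + \sum_(w \in wminus J xi p) c w *: wR w].

(* The element of the symmetric algebra of the weight lattice defined by w. *)
Definition lin (w : 'rV[int]_n) : zpoly n :=
  \sum_(i < n) mpoly.mpolyX int (mpoly.mnm1 i) *~ w 0 i.

End Toric.

(** * Singular cohomology *)

Section Singular.
Variable R : realType.

(* R^oo with the product topology; the k-simplex lies in the first k+1
   coordinates, so that all the singular simplices of X have the same type. *)
Definition Rinf := {ptws nat -> R}.

Definition Delta (k : nat) : set Rinf :=
  [set t : Rinf | [/\ forall j, 0 <= t j, forall j, (k < j)%N -> t j = 0
                    & \sum_(j < k.+1) t j = 1]].

Variable X : topologicalType.

Definition simplex (k : nat) (sigma : Rinf -> X) : Prop :=
  {within Delta k, continuous sigma}.

(* c k is the component of degree k; it only matters on simplices of dimension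
   k, and must not depend on the values of sigma outside of Delta k. *)
Definition cochain := nat -> (Rinf -> X) -> int.

Definition wf_cochain (c : cochain) : Prop :=
  forall k (sigma sigma' : Rinf -> X),
    (forall t, Delta k t -> sigma t = sigma' t) -> c k sigma = c k sigma'.

Definition insert0 (i : nat) (t : Rinf) : Rinf :=
  fun j => if (j < i)%N then t j else if j == i then 0 else t j.-1.

Definition coboundary (c : cochain) : cochain := fun k sigma =>
  match k with
  | 0 => 0
  | k'.+1 => \sum_(i < k'.+2) (-1) ^+ i * c k' (sigma \o insert0 i)
  end.

(* Representatives of the elements of H^*(X; Z), the direct sum of the H^k. *)
Definition cocycle (c : cochain) : Prop :=
  [/\ wf_cochain c,
      exists N, forall k sigma, (N < k)%N -> simplex k sigma -> c k sigma = 0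
    & forall k sigma, simplex k sigma -> coboundary c k sigma = 0].

Definition cohomologous (c c' : cochain) : Prop :=
  exists2 b, wf_cochain b & forall k sigma, simplex k sigma ->
    c k sigma - c' k sigma = coboundary b k sigma.

Definition pure (d : nat) (c : cochain) : Prop :=
  forall k sigma, k <> d -> simplex k sigma -> c k sigma = 0.

Definition back_face (i : nat) (t : Rinf) : Rinf :=
  fun j => if (j < i)%N then 0 else t (j - i)%N.

(* The front face needs no map, since Delta i is a subset of Delta k. *)
Definition cup (c d : cochain) : cochain := fun k sigma =>
  \sum_(i < k.+1) c i sigma * d (k - i)%N (sigma \o back_face i).

Definition cup1 : cochain := fun k _ => (k == 0%N)%:R.

Definition cup_monomial n (x : 'I_n -> cochain) (m : mpoly.multinom n) :
    cochain :=
  \big[cup/cup1]_(j < n) iter (m j) (cup (x j)) cup1.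

Definition cup_eval n (x : 'I_n -> cochain) (f : zpoly n) : cochain :=
  fun k sigma => \sum_(m <- mpoly.msupp f)
    mpoly.mcoeff m f * cup_monomial x m k sigma.

End Singular.

Definition pullback (R : realType) (X Y : topologicalType) (f : X -> Y)
    (c : cochain R Y) : cochain R X :=
  fun k sigma => c k (f \o sigma).

(** * The Borel construction *)

Section Borel.
Variables (R : realType) (n : nat).

Record torus_space := TorusSpace {
  tpoints :> topologicalType;
  tact : 'rV[R]_n -> tpoints -> tpoints;
  tact0 : forall p, tact 0 p = p;
  tactD : forall s t p, tact (s + t) p = tact s (tact t p)
}.

Definition rot (th : R) (z : R * R) : R * R :=
  (cos th * z.1 - sin th * z.2, sin th * z.1 + cos th * z.2).

(* ET is (C^oo minus 0)^n, where C^oo has the product topology: it is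
   contractible, and the j-th circle acts freely on the j-th factor by
   complex multiplication. *)
Definition ET : set {ptws ('I_n * nat)%type -> (R * R)%type} :=
  [set e | forall j, exists k, e (j, k) <> (0, 0)].

Lemma rot_neq0 th z : z <> (0, 0) -> rot th z <> (0, 0).
Proof.
move=> z0 []; set c := cos th; set s := sin th => h1 h2; apply: z0.
have cs : c ^+ 2 + s ^+ 2 = 1 by rewrite /c /s cos2Dsin2.
have -> : z = ((c ^+ 2 + s ^+ 2) * z.1, (c ^+ 2 + s ^+ 2) * z.2).
  by rewrite cs !mul1r; case: z {h1 h2}.
congr (_, _).
- rewrite (_ : _ * _ = c * (c * z.1 - s * z.2) + s * (s * z.1 + c * z.2)).
    by rewrite h1 h2 !mulr0 addr0.
  by ring.
- rewrite (_ : _ * _ = c * (s * z.1 + c * z.2) - s * (c * z.1 - s * z.2)).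
    by rewrite h1 h2 !mulr0 subr0.
  by ring.
Qed.

Definition rotE (s : 'rV[R]_n) (e : {ptws ('I_n * nat)%type -> (R * R)%type}) :
    {ptws ('I_n * nat)%type -> (R * R)%type} :=
  fun jk => rot (2 * pi * s 0 jk.1) (e jk).

Lemma rotE_subproof s (e : ET) : rotE s (set_val e) \in ET.
Proof.
apply/mem_set => j; have [k ek] := set_mem (valP e) j.
by exists k; exact: rot_neq0.
Qed.

Definition actE (s : 'rV[R]_n) (e : ET) : ET :=
  exist _ (rotE s (set_val e)) (rotE_subproof s e).

Lemma actE0 e : actE 0 e = e.
Proof.
apply: val_inj; apply: funext => jk /=; rewrite /rotE /rot mxE mulr0 cos0 sin0.
by rewrite !mul1r !mul0r subr0 add0r -surjective_pairing.
Qed.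

Lemma actED s t e : actE (s + t) e = actE s (actE t e).
Proof.
apply: val_inj; apply: funext => jk /=; rewrite /rotE /rot mxE mulrDr cosD sinD /=.
by congr (_, _); ring.
Qed.

Section Quotient.
Variable X : torus_space.

Definition same_orbit (z z' : X * ET) : bool :=
  `[< exists s, z' = (tact s z.1, actE s z.2) >].

Lemma same_orbit_refl : reflexive same_orbit.
Proof. by case=> x e; apply/asboolP; exists 0; rewrite tact0 actE0. Qed.

Lemma same_orbit_sym : symmetric same_orbit.
Proof.
suff h z z' : same_orbit z z' -> same_orbit z' z.
  by move=> z z'; apply/idP/idP; exact: h.
case: z => x e /asboolP[s ->]; apply/asboolP; exists (- s) => /=.
by rewrite -tactD -actED addNr tact0 actE0.
Qed.

Lemma same_orbit_trans : transitive same_orbit.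
Proof.
move=> z z' z'' /asboolP[s ->] /asboolP[t ->]; apply/asboolP.
by exists (t + s) => /=; rewrite tactD actED.
Qed.

Canonical same_orbit_equiv :=
  EquivRel same_orbit same_orbit_refl same_orbit_sym same_orbit_trans.

Definition borel : topologicalType :=
  quotient_topology {eq_quot same_orbit_equiv}.

Definition borel_class (x : X) (e : ET) : borel :=
  \pi_({eq_quot same_orbit_equiv}) (x, e).

End Quotient.

Definition torus_pt : torus_space :=
  @TorusSpace 'rV[R]_0 (fun _ p => p) (fun _ => erefl) (fun _ _ _ => erefl).

Definition BT : topologicalType := borel torus_pt.

Definition BT_class (e : ET) : BT := @borel_class torus_pt 0 e.

(* x j represents the generator x_j of H^2(BT; Z), i.e. the first Chern class of
   the line bundle ET x_T C given by the j-th coordinate character of T.  It is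
   characterized by its values on the spheres in BT obtained from the discs
   D in ET whose boundary is, up to a constant part, an orbit of the loop
   t |-> exp(t m). *)
Definition chern_classes (x : 'I_n -> cochain R BT) : Prop :=
  forall j, [/\ cocycle (x j), pure 2 (x j) &
    forall (m : 'rV[int]_n) (e : ET) (D : Rinf R -> ET),
      {within Delta 2, continuous D} ->
      (forall t, Delta 2 t -> t 2%N = 0 -> D t = actE (t 1%N *: wR R m) e) ->
      (forall t, Delta 2 t -> t 0%N = 0 \/ t 1%N = 0 -> D t = e) ->
      x j 2%N (BT_class \o D) - x j 2%N (fun=> BT_class e) = m 0 j].

End Borel.

(** * Equivariant cohomology classes of a symplectic toric manifold *)

Section Classes.
Variables (R : realType) (n : nat) (M : symplectic_toric R n).

Definition torus_mfd : torus_space R n := TorusSpace (@act0 _ _ M) (@actD _ _ M).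

(* M x_T ET *)
Definition MT : topologicalType := borel torus_mfd.

(* Induced by the inclusion of q; well defined for q fixed. *)
Definition incl_fixed (q : M) (z : BT R n) : MT :=
  @borel_class R n torus_mfd q
    (repr (z : {eq_quot same_orbit_equiv (torus_pt R n)})).2.

Variable x : 'I_n -> cochain R (BT R n).

(* tau(q) = f, where H_T^*(pt; Z) is identified with Z[x_1, ..., x_n] *)
Definition restricts (tau : cochain R MT) (q : M) (f : zpoly n) : Prop :=
  cohomologous (pullback (incl_fixed q) tau) (cup_eval x f).

Variables (J : acs M) (xi : 'rV[R]_n).

Definition Lambda_minus (p : M) : zpoly n :=
  \big[*%R/1]_(w \in wplus J xi p) lin w.

Definition kirwan (p : M) (nu : cochain R MT) : Prop :=
  [/\ cocycle nu, restricts nu p (Lambda_minus p)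
    & forall q, fixed q -> mu xi q < mu xi p -> restricts nu q 0].

Definition normal_euler (p q : M) : zpoly n :=
  \big[*%R/1]_(r \in [set r | [/\ fixed r, ~ flow_up J xi p r & edge r q]])
    lin (edge_weight r q).

Definition poincare_dual (p : M) (eta : cochain R MT) : Prop :=
  [/\ cocycle eta, pure (lambda J xi p).*2 eta,
      forall q, fixed q -> ~ flow_up J xi p q -> restricts eta q 0
    & forall q, fixed q -> flow_up J xi p q ->
        restricts eta q (normal_euler p q)].

(** ** Local index *)

(* Z[w_0, ..., w_n] is zpoly n.+1; W0 is w_0 and W i is w_(i+1). *)
Definition W0 : zpoly n.+1 := mpoly.mpolyX int (mpoly.mnm1 ord0).
Definition W (i : 'I_n) : zpoly n.+1 :=
  mpoly.mpolyX int (mpoly.mnm1 (lift ord0 i)).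

Definition subst k l (f : zpoly k) (g : 'I_k -> zpoly l) : zpoly l :=
  mpoly.comp_mpoly [tuple g i | i < k] f.

Section Integral.
Variables (lam : nat) (f : zpoly n).

Definition f_0 : zpoly n.+1 :=
  subst f (fun i => if (i < lam)%N then W0 + W i else W i).

Definition f_ (j : 'I_n) : zpoly n.+1 :=
  subst f (fun i => if (i < lam)%N then W i - W j else W i).

Definition integral_CP : {fraction zpoly n.+1} :=
  tofrac f_0 / tofrac (\prod_(k < n | (k < lam)%N) (W k + W0))
  + \sum_(j < n | (j < lam)%N)
      tofrac (f_ j) /
      tofrac ((- W j - W0) *
              \prod_(k < n | (k < lam)%N && (k != j)) (W k - W j)).

End Integral.

Definition adapted_basis (q : M) (w : 'I_n -> 'rV[int]_n) : Prop :=
  [/\ injective w, range w = weights J q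
    & forall i, wplus J xi q (w i) <-> (i < lambda J xi q)%N].

(* Ind_q(tau) = g *)
Definition local_index (q : M) (tau : cochain R MT) (g : zpoly n) : Prop :=
  exists w f h,
    [/\ adapted_basis q w,
        restricts tau q (subst f (fun i => lin (w i))),
        tofrac h = integral_CP (lambda J xi q) f
      & g = subst h (fun i => oapp (fun j => lin (w j)) 0 (unlift ord0 i))].

Definition i_canonical (p : M) (tau : cochain R MT) : Prop :=
  [/\ kirwan p tau, local_index p tau 1
    & forall q, fixed q -> q <> p -> local_index q tau 0].

End Classes.

(** * Classical theorems on symplectic toric manifolds

   Every symplectic toric manifold satisfies the two predicates below.  They are
   the background theorems through which moment polytope, isotropy weights and
   equivariant cohomology are related; nothing in them depends on a component
   of the moment map. *)

Section Background.
Variables (R : realType) (n : nat) (M : symplectic_toric R n).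

(* Atiyah, Guillemin-Sternberg, Delzant *)
Record convexity_theorem (J : acs M) : Prop := ConvexityTheorem {
  fixed_finite : finite_set [set q : M | fixed q];
  psi_fixed_inj : forall q r : M, fixed q -> fixed r -> psi q = psi r -> q = r;
  psi_image : range (@psi _ _ M) = conv_hull [set psi q | q in @fixed _ _ M];
  psi_vertex : forall q : M, fixed q -> face (range (@psi _ _ M)) [set psi q];
  weights_basis : forall q : M, fixed q ->
    exists2 A : 'M[int]_n, A \in unitmx & weights J q = range (fun i => row i A);
  weights_edges : forall q : M, fixed q ->
    set_bij [set r | edge r q] (weights J q) (fun r => edge_weight r q)
}.

(* H_T^*(pt; Z) = Z[x_1, ..., x_n]; restriction to the fixed points is injective
   and its image is described by the GKM graph (Kirwan, Chang-Skjelbred,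
   Goresky-Kottwitz-MacPherson) *)
Record localization_theorem (x : 'I_n -> cochain R (BT R n)) : Prop :=
  LocalizationTheorem {
  point_surj : forall c, cocycle c -> exists f, cohomologous c (cup_eval x f);
  point_inj : forall f g,
    cohomologous (cup_eval x f) (cup_eval x g) -> f = g;
  restriction_inj : forall tau tau' : cochain R (MT M),
    cocycle tau -> cocycle tau' ->
    (forall q : M, fixed q ->
       cohomologous (pullback (incl_fixed q) tau)
                    (pullback (incl_fixed q) tau')) ->
    cohomologous tau tau';
  restriction_image : forall f : M -> zpoly n,
    (exists2 tau : cochain R (MT M), cocycle tau &
       forall q : M, fixed q -> restricts x tau q (f q)) <->
    (forall r q : M, edge r q ->
       exists g, f q - f r = lin (edge_weight r q) * g)
}.

End Background.

(* Main.v *)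
(* Every class involved is determined by its restrictions to the fixed
   points, so the argument takes place on the moment polytope. Each vertex
   cone of the polytope is generated by the edges at the vertex; hence the
   isotropy weights at the two ends of an edge agree modulo the weight of
   the edge, and the number of edges at q in F_p that leave F_p is
   lambda_p. The first fact makes the restrictions of eta_p satisfy the
   GKM congruences, the second makes them homogeneous of degree lambda_p.

   eta_p(q) is a product of isotropy weights at q. If q <> p lies in F_p,
   some edge of F_p descends from q, so that a weight of W_q^+ is missing
   from this product; the local index is then the integral of a constant
   over a projective space of positive dimension, which is 0.

   If two classes have the same local indices, the difference of their
   restrictions vanishes: at a fixed point q minimizing mu among those
   where it does not, it is divisible by each weight of W_q^+, and then
   the local index at q determines it. *)
Require Import Defs.
From mathcomp Require Import all_boot all_order all_algebra.
From mathcomp Require Import all_classical all_reals all_analysis ring lra.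
From mathcomp Require mpoly.
Import (canonicals, coercions) mpoly.

Set Implicit Arguments.
Unset Strict Implicit.
Unset Printing Implicit Defensive.

Import Order.TTheory GRing.Theory Num.Theory.
Import numFieldNormedType.Exports.
Local Open Scope classical_set_scope.
Local Open Scope ring_scope.

Local Notation var i := (mpoly.mpolyX int (mpoly.mnm1 i)).
Local Notation homog d := (@mpoly.ishomog1 _ _ d mpoly.mdeg).

(** * Lagrange interpolation and substitutions *)

(** Lagrange interpolation of the constant 1 at the points [z a] returns the constant 1. The sum is
    the coefficient of degree [#|P|.-1] of the interpolation polynomial, and this degree is
    positive. *)
Lemma sum_inv_prod_diff (F : fieldType) (T : finType) (P : pred T)
    (z : T -> F) :
    {in P &, injective z} -> (1 < #|P|)%N ->
  \sum_(a | P a) (\prod_(b | P b && (b != a)) (z a - z b))^-1 = 0.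
Proof.
move=> zI P1.
pose L a := \prod_(b | P b && (b != a)) ('X - (z b)%:P).
pose c a := (\prod_(b | P b && (b != a)) (z a - z b))^-1.
have cardPD a : P a -> #|[pred b | P b && (b != a)]| = #|P|.-1.
  move=> Pa; rewrite (cardD1 a P) (_ : a \in P) //=.
  by apply: eq_card => b; rewrite !inE andbC.
have sL a : P a -> size (L a) = #|P|.
  move=> Pa; rewrite /L -big_filter size_prod_XsubC -(prednK (ltnW P1))
    -(cardPD a Pa).
  by rewrite cardE [index_enum T]unlock.
have nzc a : P a -> \prod_(b | P b && (b != a)) (z a - z b) != 0.
  move=> Pa; apply/prodf_neq0 => b /andP[Pb ba]; rewrite subr_eq0.
  by apply: contra ba => /eqP /(zI a b Pa Pb) ->.
(* The interpolation polynomial minus 1 has [#|P|] distinct roots and size at most [#|P|], hence is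
   0. *)
pose p := \sum_(a | P a) c a *: L a - 1.
have szp : (size p <= #|P|)%N.
  rewrite (leq_trans (size_polyD _ _))// geq_max size_polyN size_poly1 (ltnW
    P1) andbT.
  apply: (leq_trans (size_sum _ _ _)); apply/bigmax_leqP => a Pa.
  by rewrite (leq_trans (size_scale_leq _ _))// sL.
have p0 : p = 0.
  apply/eqP; apply: contraTT szp => pn0; rewrite -ltnNge.
  have := @max_poly_roots _ p (map z (enum P)) pn0.
  rewrite size_map -cardE; apply.
    apply/allP => _ /mapP[a + ->]; rewrite mem_enum => Pa.
    rewrite /root /p !hornerE horner_sum (bigD1 a)//= [X in _ + X - _]big1
      ?addr0.
      rewrite hornerZ horner_prod; under eq_bigr do rewrite !hornerE.
      by rewrite /c mulVf ?subrr ?nzc.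
    move=> a' /andP[Pa' aa']; rewrite hornerZ horner_prod.
    rewrite (bigD1 a) /=; last by rewrite eq_sym aa' andbT.
    by rewrite hornerXsubC subrr mul0r mulr0.
  rewrite map_inj_in_uniq ?enum_uniq// => a b; rewrite !mem_enum; exact: zI.
have lc a : P a -> (L a)`_(#|P|.-1) = 1.
  move=> Pa; rewrite -(sL a Pa) -lead_coefE; apply/monicP.
  by apply: monic_prod => b _; exact: monicXsubC.
transitivity (p`_(#|P|.-1)); last by rewrite p0 coef0.
rewrite /p coefB coef1 -[_.-1 == _]negbK -lt0n -subn1 subn_gt0 P1 subr0
  coef_sum.
by apply: eq_bigr => a Pa; rewrite coefZ subn1 lc ?mulr1.
Qed.

Section Substitution.

Lemma substX k l (g : 'I_k -> zpoly l) i : subst (var i) g = g i.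
Proof. by rewrite /subst mpoly.comp_mpolyXU -tnth_nth tnth_mktuple. Qed.

Lemma substM k l (g : 'I_k -> zpoly l) f f' :
  subst (f * f') g = subst f g * subst f' g.
Proof. exact: (rmorphM (mpoly.comp_mpoly _)). Qed.

Lemma substB k l (g : 'I_k -> zpoly l) f f' :
  subst (f - f') g = subst f g - subst f' g.
Proof. exact: (rmorphB (mpoly.comp_mpoly _)). Qed.

Lemma substD k l (g : 'I_k -> zpoly l) f f' :
  subst (f + f') g = subst f g + subst f' g.
Proof. exact: (rmorphD (mpoly.comp_mpoly _)). Qed.

Lemma subst0 k l (g : 'I_k -> zpoly l) : subst 0 g = 0.
Proof. exact: (rmorph0 (mpoly.comp_mpoly _)). Qed.

Lemma subst1 k l (g : 'I_k -> zpoly l) : subst 1 g = 1.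
Proof. exact: (rmorph1 (mpoly.comp_mpoly _)). Qed.

Lemma substMz k l (g : 'I_k -> zpoly l) f c : subst (f *~ c) g = subst f g *~ c.
Proof. exact: (raddfMz (mpoly.comp_mpoly _)). Qed.

Lemma subst_sum k l (g : 'I_k -> zpoly l) I (r : seq I) P F :
  subst (\sum_(i <- r | P i) F i) g = \sum_(i <- r | P i) subst (F i) g.
Proof. exact: (raddf_sum (mpoly.comp_mpoly _)). Qed.

Lemma subst_prod k l (g : 'I_k -> zpoly l) I (r : seq I) P F :
  subst (\prod_(i <- r | P i) F i) g = \prod_(i <- r | P i) subst (F i) g.
Proof. exact: (rmorph_prod (mpoly.comp_mpoly _)). Qed.

Lemma eq_subst k l (g g' : 'I_k -> zpoly l) f : g =1 g' ->
  subst f g = subst f g'.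
Proof. by move=> /funext ->. Qed.

Lemma substE k l (g : 'I_k -> zpoly l) f :
  subst f g = \sum_(m <- mpoly.msupp f)
                 (\prod_(i < k) g i ^+ m i) *~ mpoly.mcoeff m f.
Proof.
rewrite /subst mpoly.comp_mpolyEX; apply: eq_bigr => m _.
rewrite mpoly.comp_mpolyX -mulrzl -mpoly.mul_mpolyC; congr (_ * _).
  rewrite -[X in mpoly.mpolyC _ X]intz.
  by rewrite (rmorph_int (@mpoly.mpolyC l int)).
by apply: eq_bigr => i _; rewrite tnth_mktuple.
Qed.

Lemma subst_subst k l j (f : zpoly k) (g : 'I_k -> zpoly l)
    (h : 'I_l -> zpoly j) :
  subst (subst f g) h = subst f (fun i => subst (g i) h).
Proof.
rewrite (substE g) subst_sum (substE (fun i => _)); apply: eq_bigr => m _.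
rewrite substMz subst_prod; congr (_ *~ _); apply: eq_bigr => i _.
exact: (rmorphXn (mpoly.comp_mpoly _)).
Qed.

End Substitution.

(** * Integrals over projective spaces *)

Section IntegralOverProjectiveSpace.
Variable n : nat.
Implicit Types (lam : nat) (K : pred 'I_n).
Local Notation zT := (zpoly n.+1).

(** Differences of these points are the isotropy weights in the localization formula for projective
    space: [W0 + W k], [- W j - W0] and [W k - W j]. *)
Definition cp_point (a : 'I_n.+1) : zT :=
  if unlift ord0 a is Some k then - W k else W0 n.

Lemma cp_point_inj : injective cp_point.
Proof.
move=> a b ab; apply/eqP; apply: contraTT isT => nab.
(* This substitution sends the point of index [a] to 1 or -1 and all the others to 0. *)
pose g i : zT := (i == a)%:R.
have sW c : subst (cp_point c) g = if c == ord0 then g c else - g c.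
  rewrite /cp_point /W /W0; case: unliftP => [k|] ->.
    by rewrite -sub0r substB subst0 sub0r substX.
  by rewrite eqxx substX.
have := congr1 (fun f => subst f g) ab;
  rewrite !sW /g eqxx (eq_sym b a) (negbTE nab).
by rewrite oppr0 if_same; case: ifP => _ /eqP; rewrite ?oppr_eq0 oner_eq0.
Qed.

Lemma W0D_neq0 (k : 'I_n) : W k + W0 n != 0.
Proof.
rewrite -[W k]opprK addrC subr_eq0; apply/eqP => h.
have := @cp_point_inj ord0 (lift ord0 k).
by rewrite /cp_point unlift_none liftK => /(_ h) /eqP;
  rewrite (negbTE (neq_lift _ _)).
Qed.

Lemma WB_neq0 (j k : 'I_n) : k != j -> W k - W j != 0.
Proof.
move=> kj; rewrite subr_eq0; apply: contra kj => /eqP h.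
have := @cp_point_inj (lift ord0 k) (lift ord0 j).
by rewrite /cp_point !liftK h => /(_ erefl) /lift_inj ->.
Qed.

Lemma big_ord_recl_cond (T : Type) (idx : T) (op : Monoid.law idx)
    (P : pred 'I_n.+1) F :
  \big[op/idx]_(i < n.+1 | P i) F i =
  op (if P ord0 then F ord0 else idx)
     (\big[op/idx]_(i < n | P (lift ord0 i)) F (lift ord0 i)).
Proof. by rewrite big_mkcond big_ord_recl -big_mkcond. Qed.

(** The integral of 1 over a projective space of positive dimension: the interpolation identity at
    the points of index 0 or in [C]. *)
Lemma sum_inv_cp (C : pred 'I_n) : (exists j, C j) ->
  (tofrac (\prod_(k < n | C k) (W k + W0 n)))^-1 +
  \sum_(j < n | C j) (tofrac ((- W j - W0 n) *
     \prod_(k < n | C k && (k != j)) (W k - W j)))^-1 = 0 :> {fraction zT}.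
Proof.
move=> [j0 Cj0].
pose P (a : 'I_n.+1) := if unlift ord0 a is Some k then C k else true.
have P0 : P ord0 by rewrite /P unlift_none.
have PS k : P (lift ord0 k) = C k by rewrite /P liftK.
have zI : {in P &, injective (fun a => tofrac (cp_point a))}.
  move=> a b _ _ /eqP; rewrite tofrac_eq => /eqP; exact: cp_point_inj.
have P1 : (1 < #|P|)%N.
  apply/card_gt1P; exists ord0, (lift ord0 j0).
  by split; [exact: P0 | rewrite -topredE /= PS | exact: neq_lift].
have := sum_inv_prod_diff zI P1; rewrite big_ord_recl_cond P0 => h;
  rewrite -{}[RHS]h.
have z0 : cp_point ord0 = W0 n by rewrite /cp_point unlift_none.
have zS k : cp_point (lift ord0 k) = - W k by rewrite /cp_point liftK.
congr (_ + _).
  rewrite big_ord_recl_cond eqxx andbF /= mul1r rmorph_prod /=; congr (_^-1).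
  apply: eq_big => k; first by rewrite PS andbT.
  by rewrite z0 zS rmorphN /= opprK -rmorphD /= addrC.
apply: eq_big => j; first by rewrite PS.
rewrite big_ord_recl_cond P0 neq_lift /= => Cj; congr (_^-1).
rewrite rmorphM rmorph_prod /=; congr (_ * _).
  by rewrite zS z0 rmorphB.
apply: eq_big => k; first by rewrite PS (inj_eq lift_inj).
by rewrite !zS -rmorphB /= opprK addrC.
Qed.

Lemma f_0_prod lam K : f_0 lam (\prod_(i < n | K i) var i) =
  \prod_(i < n | K i && (i < lam)%N) (W i + W0 n)
    * \prod_(i < n | K i && ~~ (i < lam)%N) W i.
Proof.
rewrite /f_0 subst_prod (bigID (fun i : 'I_n => (i < lam)%N)) /=.
by congr (_ * _); apply: eq_bigr => i /andP[_ h];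
  rewrite substX ?h ?(negbTE h) 1?addrC.
Qed.

Lemma f_prod lam K (j : 'I_n) : f_ lam (\prod_(i < n | K i) var i) j =
  \prod_(i < n | K i && (i < lam)%N) (W i - W j)
    * \prod_(i < n | K i && ~~ (i < lam)%N) W i.
Proof.
rewrite /f_ subst_prod (bigID (fun i : 'I_n => (i < lam)%N)) /=.
by congr (_ * _); apply: eq_bigr => i /andP[_ h]; rewrite substX ?h ?(negbTE h).
Qed.

Lemma f_prod_eq0 lam K (j : 'I_n) : K j -> (j < lam)%N ->
  f_ lam (\prod_(i < n | K i) var i) j = 0.
Proof. by move=> Kj jl; rewrite f_prod (bigD1 j) ?Kj//= subrr !mul0r. Qed.

Lemma integral_CP_0 lam : integral_CP lam (0 : zpoly n) = 0.
Proof.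
rewrite /integral_CP /f_0 /f_ subst0 rmorph0 mul0r add0r big1// => j _.
by rewrite subst0 rmorph0 mul0r.
Qed.

Lemma integral_CP_f_0 lam (f : zpoly n) :
  (forall j : 'I_n, (j < lam)%N -> f_ lam f j = 0) ->
  integral_CP lam f =
  tofrac (f_0 lam f) / tofrac (\prod_(k < n | (k < lam)%N) (W k + W0 n)).
Proof.
move=> fj0; rewrite /integral_CP -[RHS]addr0; congr (_ + _).
by apply: big1 => j jl; rewrite fj0// rmorph0 mul0r.
Qed.

(** Only the 0-th fixed point contributes, and there numerator and denominator agree. This gives the
    local index 1 at [p]. *)
Lemma integral_CP_euler lam :
  integral_CP lam (\prod_(i < n | (i < lam)%N) var i) = 1.
Proof.
rewrite integral_CP_f_0 => [|j jl]; last exact: f_prod_eq0.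
have -> : f_0 lam (\prod_(i < n | (i < lam)%N) var i) =
    \prod_(k < n | (k < lam)%N) (W k + W0 n).
  rewrite f_0_prod [X in _ * X]big1 ?mulr1 => [|i]; last by case: (i < lam)%N.
  by apply: eq_bigl => k; rewrite andbb.
rewrite divff// tofrac_eq0; apply/prodf_neq0 => k _; exact: W0D_neq0.
Qed.

Lemma frac_cancel (F : fieldType) (p b c : F) : p != 0 ->
  p * b / (p * c) = b * c^-1.
Proof. by move=> p0; rewrite invfM mulrACA divff ?mul1r. Qed.

(* Cancelling the normal weights leaves the integral of a constant over the
   projective space spanned by the remaining weights, which vanishes. *)
Lemma integral_CP_prod_eq0 lam K (j : 'I_n) : (j < lam)%N -> ~~ K j ->
  integral_CP lam (\prod_(i < n | K i) var i) = 0.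
Proof.
move=> jl Kj; pose C := [pred i : 'I_n | (i < lam)%N && ~~ K i].
pose b : {fraction zT} := tofrac (\prod_(i < n | K i && ~~ (i < lam)%N) W i).
have -> : integral_CP lam (\prod_(i < n | K i) var i) = b *
  ((tofrac (\prod_(k < n | C k) (W k + W0 n)))^-1 +
  \sum_(j < n | C j) (tofrac ((- W j - W0 n) *
     \prod_(k < n | C k && (k != j)) (W k - W j)))^-1).
  rewrite /integral_CP mulrDr; congr (_ + _).
    rewrite f_0_prod (_ : \prod_(k < n | (k < lam)%N) (W k + W0 n) =
      \prod_(i < n | K i && (i < lam)%N) (W i + W0 n)
        * \prod_(k < n | C k) (W k + W0 n)).
      rewrite !rmorphM /= frac_cancel ?tofrac_eq0//.
      by apply/prodf_neq0 => k _; exact: W0D_neq0.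
    by rewrite (bigID K); congr (_ * _); apply: eq_bigl => i; rewrite andbC.
  rewrite (bigID K) /= big1 ?add0r => [|i /andP[il Ki]]; last first.
    by rewrite f_prod_eq0// rmorph0 mul0r.
  rewrite mulr_sumr; apply: eq_bigr => i /andP[il Ki].
  rewrite f_prod (_ : \prod_(k < n | (k < lam)%N && (k != i)) (W k - W i) =
    \prod_(k < n | K k && (k < lam)%N) (W k - W i)
      * \prod_(k < n | C k && (k != i)) (W k - W i)).
    rewrite mulrCA !rmorphM /= frac_cancel ?tofrac_eq0//.
    apply/prodf_neq0 => k /andP[Kk _].
    by apply: WB_neq0; apply: contraNneq Ki => <-.
  rewrite (bigID K); congr (_ * _); apply: eq_bigl => k /=;
    last by rewrite andbAC.
  case: (eqVneq k i) => [->|]; first by rewrite (negbTE Ki) !andbF.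
  by rewrite andbT andbC.
by rewrite sum_inv_cp ?mulr0//; exists j; rewrite /C /= jl.
Qed.

(* The other fixed points contributing nothing, f_0 is divisible by the
   product of the w_k + w_0. *)
Lemma integral_CP_eq0P lam (f : zpoly n) h :
  (forall j : 'I_n, (j < lam)%N -> f_ lam f j = 0) ->
  tofrac h = integral_CP lam f ->
  f_0 lam f = h * \prod_(k < n | (k < lam)%N) (W k + W0 n).
Proof.
move=> fj0; rewrite integral_CP_f_0// => hE.
apply/eqP; rewrite -tofrac_eq rmorphM /= hE divfK//.
by rewrite tofrac_eq0; apply/prodf_neq0 => k _; exact: W0D_neq0.
Qed.

Lemma integral_CPB lam (f f' : zpoly n) :
  integral_CP lam (f - f') = integral_CP lam f - integral_CP lam f'.
Proof.
rewrite /integral_CP /f_0 /f_ !substB !rmorphB /= mulrBl opprD -!addrA;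
  congr (_ + _).
rewrite addrCA; congr (_ + _); rewrite -sumrB; apply: eq_bigr => j _.
by rewrite !substB rmorphB mulrBl.
Qed.

End IntegralOverProjectiveSpace.

(** * Weights as linear polynomials *)

Section LinearForms.
Variable n : nat.
Implicit Types u v w : 'rV[int]_n.

Lemma linD : {morph @lin n : u v / u + v}.
Proof.
move=> u v; rewrite /lin -big_split; apply: eq_bigr => i _ /=.
by rewrite mxE mulrzDr.
Qed.

Lemma linZ c u : lin (c *: u) = lin u *~ c.
Proof.
rewrite /lin mulrz_suml; apply: eq_bigr => i _.
by rewrite mxE mulrC mulrzA.
Qed.

Lemma lin_homog u : lin u \is homog 1%N.
Proof.
apply: rpred_sum => i _; apply: rpredMz.
by rewrite mpoly.dhomogX; apply/eqP; exact: mpoly.mdeg1.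
Qed.

Lemma prod_lin_homog (P : pred 'I_n) (w : 'I_n -> 'rV[int]_n) :
  \prod_(i | P i) lin (w i) \is homog #|P|.
Proof.
rewrite -sum1_card.
elim/big_rec2: _ => [|i d f _ fd]; first exact: mpoly.dhomog1.
exact: mpoly.dhomogM (lin_homog _) fd.
Qed.

(* A substitution sending w_k to 0 factors through the quotient by lin w_k as
   soon as the w_i form a Z-basis. *)
Lemma f_eq0 (w : 'I_n -> 'rV[int]_n) (lam : nat) (k : 'I_n) f g :
  \matrix_i w i \in unitmx -> (k < lam)%N ->
  subst f (fun i => lin (w i)) = lin (w k) * g -> f_ lam f k = 0.
Proof.
move=> wU kl fE; pose B := invmx (\matrix_i w i).
pose t (i : 'I_n) : zpoly n.+1 := if (i < lam)%N then W i - W k else W i.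
(* Written in coordinates through the inverse matrix [B], [rho] is the substitution that sends each
   [lin (w i)] to [t i]. *)
pose rho i := \sum_j t j *~ B i j.
have rhoE i : subst (lin (w i)) rho = t i.
  have : (\matrix_i w i *m B) = 1%:M by rewrite mulmxV.
  move/matrixP => wB.
  rewrite /lin subst_sum; under eq_bigr do rewrite substMz substX /rho
    mulrz_suml.
  rewrite exchange_big /= (bigD1 i)//= [X in _ + X]big1 ?addr0 => [|j ji].
    have := wB i i; rewrite !mxE eqxx => wBi.
    under eq_bigr do rewrite -mulrzA; rewrite -mulrz_sumr.
    rewrite (_ : \sum_ _ _ = 1)//; apply: etrans wBi; apply: eq_bigr => l _.
    by rewrite mxE mulrC.
  have := wB i j; rewrite !mxE eq_sym (negbTE ji) => wBi.
  under eq_bigr do rewrite -mulrzA; rewrite -mulrz_sumr.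
  rewrite (_ : \sum_ _ _ = 0)//; apply: etrans wBi; apply: eq_bigr => l _.
  by rewrite mxE mulrC.
have -> : f_ lam f k = subst (subst f (fun i => lin (w i))) rho.
  by rewrite subst_subst /f_; apply: eq_subst => i; rewrite rhoE.
by rewrite fE substM rhoE /t kl subrr mul0r.
Qed.

End LinearForms.

(** * Cochains *)

Section Cochains.
Variables (R : realType) (X : topologicalType).
Implicit Types (c b : cochain R X).

Lemma coboundaryB c c' k sigma :
  @coboundary R X (fun j s => c j s - c' j s) k sigma =
  coboundary c k sigma - coboundary c' k sigma.
Proof.
case: k => [|k] /=; first by rewrite subrr.
by rewrite -sumrB; apply: eq_bigr => i _; rewrite mulrBr.
Qed.

Lemma coboundary0 k sigma :
  @coboundary R X (fun _ _ => 0 : int) k sigma = 0 :> int.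
Proof.
case: k => [|k] //=; apply: big1 => i _; exact: mulr0.
Qed.

Lemma cohomologous_sym c c' : cohomologous c c' -> cohomologous c' c.
Proof.
move=> [b wfb bE]; exists (fun j s => 0 - b j s).
  by move=> k s s' ss'; rewrite (wfb _ _ _ ss').
by move=> k s /bE h; rewrite coboundaryB coboundary0 -h sub0r opprB.
Qed.

Lemma cohomologous_trans c' c c'' :
  cohomologous c c' -> cohomologous c' c'' -> cohomologous c c''.
Proof.
move=> [b wfb bE] /cohomologous_sym[b' wfb' b'E].
exists (fun j s => b j s - b' j s).
  by move=> k s s' ss'; rewrite (wfb _ _ _ ss') (wfb' _ _ _ ss').
move=> k s ks; rewrite coboundaryB -bE// -b'E//; ring.
Qed.

(** The GKM description of the restrictions yields a cocycle of possibly mixed degree; a Poincaré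
    dual is pure, and is obtained as a component of it. *)
Definition degree_part d c : cochain R X :=
  fun k sigma => if k == d then c k sigma else 0.

Lemma pure_degree_part d c : pure d (degree_part d c).
Proof. by move=> k sigma /eqP /negbTE kd _; rewrite /degree_part kd. Qed.

Lemma coboundary_degree_part d c k sigma :
  coboundary (degree_part d c) k sigma =
  if k == d.+1 then coboundary c k sigma else 0.
Proof.
case: k => [|k] //=; rewrite eqSS /degree_part; case: ifP => // _.
by apply: big1 => i _; exact: mulr0.
Qed.

Lemma cocycle_degree_part d c : cocycle c -> cocycle (degree_part d c).
Proof.
move=> [wfc [N cN] cc]; split.
- by move=> k s s' ss'; rewrite /degree_part (wfc _ _ _ ss').
- by exists N => k s Nk ks; rewrite /degree_part cN// if_same.
- by move=> k s ks; rewrite coboundary_degree_part cc// if_same.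
Qed.

Lemma cohomologous_degree_part d c c' :
  cohomologous c c' -> pure d c' -> cohomologous (degree_part d c) c'.
Proof.
move=> [b wfb bE] c'd.
(* The coboundary raises degrees by one, so only the part of [b] of degree [d - 1] is kept. *)
exists (fun k s => if k.+1 == d then b k s else 0).
  by move=> k s s' ss'; rewrite (wfb _ _ _ ss').
move=> k s ks; rewrite /degree_part.
have -> : @coboundary R X (fun k s => if k.+1 == d then b k s else 0) k s =
    if k == d then coboundary b k s else 0.
  case: k ks => [|k] _ /=; first by rewrite if_same.
  by case: ifP => // _; apply: big1 => i _; exact: mulr0.
by have [|/eqP kd] := eqVneq k d; [rewrite -bE | rewrite c'd// subrr].
Qed.

End Cochains.

(** * Degrees of cup products *)

Section CupProducts.
Variables (R : realType) (X : topologicalType).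
Implicit Types c : cochain R X.

(** In [cup] the front face of [sigma] is [sigma] itself, seen as a simplex of lower dimension; this
    inclusion makes it one. *)
Lemma DeltaW i k : (i <= k)%N -> @Delta R i `<=` @Delta R k.
Proof.
move=> ik t [t0 ti t1]; split=> // [j kj|]; first by apply: ti;
  exact: leq_ltn_trans kj.
rewrite -(big_mkord xpredT (fun j => t j)) (big_cat_nat _ (n := i.+1))//=.
rewrite big_mkord t1 big_nat_cond big1 ?addr0// => j.
by rewrite andbT => /andP[ij _]; exact: ti.
Qed.

Lemma simplexW i k (sigma : Rinf R -> X) : (i <= k)%N ->
  simplex k sigma -> simplex i sigma.
Proof. by move=> ik; apply: continuous_subspaceW; exact: DeltaW. Qed.

Lemma back_face_continuous i :
  continuous (back_face i : {ptws nat -> R} -> {ptws nat -> R}).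
Proof.
move=> t.
apply: (@pointwise_cvgP nat R (back_face i @ nbhs t) (back_face i t) _).2 => j.
suff : (fun u : {ptws nat -> R} =>
  back_face i u j) @ nbhs t --> back_face i t j by [].
rewrite /back_face; case: ifP => _; first exact: cvg_cst.
exact: (@proj_continuous nat (fun=> R) (j - i)%N t).
Qed.

Lemma Delta_back_face i k (t : Rinf R) : (i <= k)%N ->
  Delta (k - i) t -> Delta k (back_face i t).
Proof.
move=> ik [t0 ti t1]; split=> [j|j kj|].
- by rewrite /back_face; case: ifP.
- rewrite /back_face ltnNge (leq_trans ik (ltnW kj)) /=; apply: ti.
  by rewrite ltn_sub2r// (leq_ltn_trans ik).
rewrite -(big_mkord xpredT (fun j => back_face i t j)).
rewrite (big_cat_nat _ (n := i))//=; last exact: leqW.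
rewrite big_nat_cond big1 ?add0r => [|j]; last first.
  by rewrite andbT /back_face => /andP[_ ->].
rewrite -{1}[i]add0n big_addn subSn// big_mkord -t1; apply: eq_bigr => j _.
by rewrite /back_face ltnNge leq_addl /= addnK.
Qed.

Lemma simplex_back_face i k (sigma : Rinf R -> X) : (i <= k)%N ->
  simplex k sigma -> simplex (k - i) (sigma \o back_face i).
Proof.
move=> ik /subspace_continuousP sk; apply/subspace_continuousP => t tD.
apply: cvg_comp (sk _ (Delta_back_face ik tD)) => U.
move=> /(@back_face_continuous i t); rewrite /= !nbhs_simpl /= => h.
by apply: filterS h => u hu uD; apply: hu; exact: Delta_back_face.
Qed.

Lemma pure_cup d e c c' : pure d c -> pure e c' -> pure (d + e) (cup c c').
Proof.
move=> cd c'e k sigma kde ks; apply: big1 => i _.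
have ik : (i <= k)%N by rewrite -ltnS.
have [id|/eqP id] := eqVneq (i : nat) d; last first.
  by rewrite cd ?mul0r//; exact: simplexW ks.
rewrite [X in _ * X]c'e ?mulr0//; last exact: simplex_back_face.
by move=> kie; apply: kde; rewrite -id -kie subnKC.
Qed.

Lemma pure_cup1 : pure 0 (@cup1 R X).
Proof. by move=> [|k] sigma. Qed.

Lemma pure_cup_monomial n (x : 'I_n -> cochain R X) (m : mpoly.multinom n) :
  (forall j, pure 2 (x j)) -> pure (mpoly.mdeg m).*2 (cup_monomial x m).
Proof.
move=> x2; rewrite /cup_monomial mpoly.mdegE -muln2 big_distrl /=.
elim/big_rec2: _ => [|j c d _ cd]; first exact: pure_cup1.
apply: pure_cup => //; elim: (m j) => [|k IH]; first exact: pure_cup1.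
by rewrite mulSn; exact: pure_cup.
Qed.

(** Links the degree of a polynomial to that of the class it represents, so that passing to a
    component in degree [d.*2] preserves homogeneous restrictions of degree [d]. *)
Lemma pure_cup_eval n (x : 'I_n -> cochain R X) d (f : zpoly n) :
  (forall j, pure 2 (x j)) -> f \is homog d -> pure d.*2 (cup_eval x f).
Proof.
move=> x2 /mpoly.dhomogP fd k sigma kd ks;
  rewrite /cup_eval big_seq big1// => m mf.
by rewrite pure_cup_monomial ?mulr0//; rewrite -(fd m mf) in kd.
Qed.

End CupProducts.

(** * The moment polytope *)

Section ConvexGeometry.
Variables (R : realType) (n : nat).
Implicit Types (u v c : 'rV[R]_n).

Lemma dotpC u v : dotp u v = dotp v u.
Proof. by apply: eq_bigr => i _; rewrite mulrC. Qed.

Lemma dotpDr c u v : dotp c (u + v) = dotp c u + dotp c v.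
Proof. by rewrite -big_split; apply: eq_bigr => i _; rewrite mxE mulrDr. Qed.

Lemma dotpZr c a u : dotp c (a *: u) = a * dotp c u.
Proof. by rewrite mulr_sumr; apply: eq_bigr => i _; rewrite mxE mulrCA. Qed.

Lemma dotpNr c u : dotp c (- u) = - dotp c u.
Proof. by rewrite -scaleN1r dotpZr mulN1r. Qed.

Lemma dotpBr c u v : dotp c (u - v) = dotp c u - dotp c v.
Proof. by rewrite dotpDr dotpNr. Qed.

Lemma dotp0r c : dotp c 0 = 0.
Proof. by rewrite -(scale0r 0) dotpZr mul0r. Qed.

Lemma dotpDl c u v : dotp (u + v) c = dotp u c + dotp v c.
Proof. by rewrite ![dotp _ c]dotpC dotpDr. Qed.

Lemma dotpZl c a u : dotp (a *: u) c = a * dotp u c.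
Proof. by rewrite ![dotp _ c]dotpC dotpZr. Qed.

Lemma dotpNl c u : dotp (- u) c = - dotp u c.
Proof. by rewrite ![dotp _ c]dotpC dotpNr. Qed.

Lemma dotpBl c u v : dotp (u - v) c = dotp u c - dotp v c.
Proof. by rewrite ![dotp _ c]dotpC dotpBr. Qed.

Lemma dotp_sumr c I (r : seq I) (P : pred I) (F : I -> 'rV[R]_n) :
  dotp c (\sum_(i <- r | P i) F i) = \sum_(i <- r | P i) dotp c (F i).
Proof.
by elim/big_rec2: _ => [|i x y _ <-]; rewrite ?dotp0r// dotpDr.
Qed.

Lemma dotp_ge0 u : 0 <= dotp u u.
Proof. by apply: sumr_ge0 => i _; rewrite -expr2 sqr_ge0. Qed.

Lemma dotp_eq0 u : dotp u u = 0 -> u = 0.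
Proof.
move=> /eqP; rewrite psumr_eq0; last by move=> i _; rewrite -expr2 sqr_ge0.
move=> /allP u0; apply/rowP => i; rewrite mxE; apply/eqP.
by have := u0 i (mem_index_enum _); rewrite -expr2 sqrf_eq0.
Qed.

(** A convex combination attains the maximum of a functional only if every point of nonzero
    coefficient does. *)
Lemma face_segment (A : set 'rV[R]_n) (c : 'rV[R]_n) (b : R) u v :
    A u -> A v -> dotp c u = b -> dotp c v = b ->
    (forall a, A a -> dotp c a <= b) ->
    (forall a, A a -> dotp c a = b -> a = u \/ a = v) ->
  face (conv_hull A) (segment u v).
Proof.
move=> Au Av cu cv cA cAb; exists c, b; split.
  move=> _ [k [a [t [at_ t1 ->]]]]; rewrite dotp_sumr -[b]mul1r -t1 mulr_suml.
  by apply: ler_sum => i _; rewrite dotpZr ler_wpM2l ?cA; case: (at_ i).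
apply/seteqP; split=> [_ [t [t0 t1 ->]]|_ [[k [a [t [at_ t1 ->]]]] cb]].
  split; last by rewrite dotpDr !dotpZr cu cv -mulrDl subrK mul1r.
  exists 2%N, (fun i => if i == ord0 then u else v),
    (fun i => if i == ord0 then 1 - t else t).
  split=> [i||]; first by case: ifP => _; rewrite ?subr_ge0.
    by rewrite big_ord_recl big_ord1 /= subrK.
  by rewrite big_ord_recl big_ord1.
have tb i : t i * (b - dotp c (a i)) = 0.
  have : \sum_i t i * (b - dotp c (a i)) = 0.
    under eq_bigr do rewrite mulrBr.
    rewrite sumrB -mulr_suml t1 mul1r -[X in X - _]cb dotp_sumr.
    by under eq_bigr do rewrite dotpZr; rewrite subrr.
  move/eqP; rewrite psumr_eq0; first by move=> /allP /(_ i (mem_index_enum _))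
    /eqP.
  by move=> j _; case: (at_ j) => aj tj; rewrite mulr_ge0// subr_ge0 cA.
pose P i := a i == u.
(* The parameter on the segment is the total coefficient of the points other than [u]; those of
   nonzero coefficient equal [v]. *)
exists (\sum_(i | ~~ P i) t i); split.
- by apply: sumr_ge0 => i _; case: (at_ i).
- by rewrite -t1 [leRHS](bigID P)/= lerDr; apply: sumr_ge0 => i _;
  case: (at_ i).
rewrite (bigID P) /= -{1}t1 [X in X - _](bigID P) /= addrK !scaler_suml.
congr (_ + _); apply: eq_bigr => i Pi; first by rewrite (eqP Pi).
have [->|ti] := eqVneq (t i) 0; first by rewrite !scale0r.
have /eqP := tb i; rewrite mulf_eq0 (negbTE ti) /= subr_eq0 => /eqP /esym ci.
by case: (cAb (a i) _ ci) => [|/eqP aiu|->//];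
  [case: (at_ i) | rewrite /P aiu in Pi].
Qed.

Lemma seq_argmax (T : eqType) (s : seq T) (f : T -> R) x : x \in s ->
  exists2 y, y \in s & forall z, z \in s -> f z <= f y.
Proof.
elim: s x => // a s IH x _; case: s IH => [|a' s] IH.
  by exists a; rewrite ?mem_head// => z; rewrite inE => /eqP ->.
have [y ys yf] := IH a' (mem_head _ _).
have [fya|fay] := leP (f y) (f a).
  exists a; first exact: mem_head.
  by move=> z; rewrite inE => /orP[/eqP->//|/yf /le_trans->].
exists y; first by rewrite inE ys orbT.
by move=> z; rewrite inE => /orP[/eqP->|/yf//]; exact: ltW.
Qed.

Lemma finite_argmax (T : choiceType) (A : set T) (f : T -> R) x :
  finite_set A -> A x -> exists2 y, A y & forall z, A z -> f z <= f y.
Proof. by move=> /finite_seqP[s ->] /(seq_argmax f). Qed.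

End ConvexGeometry.

(** * Edges at a vertex of the moment polytope *)

Section MomentPolytope.
Variables (R : realType) (n : nat) (M : symplectic_toric R n) (J : acs M).
Hypothesis Hconv : convexity_theorem J.
Implicit Types (p q r s u : M).

(** A functional whose maximum over the polytope is attained at [psi u] only is affine on the
    segment, hence is also maximal at [psi q]. *)
Lemma fixed_not_between q s u (t : R) : fixed q -> fixed s -> fixed u ->
  0 < t < 1 -> psi u = (1 - t) *: psi q + t *: psi s -> q = u.
Proof.
move=> fq fs fu /andP[t0 t1] uE; have [h [b [hb hu]]] := psi_vertex Hconv fu.
apply: (psi_fixed_inj Hconv) => //.
have [_ hub] : [set y | range (@psi _ _ M) y /\ dotp h y = b] (psi u) by
  rewrite -hu.
have hq : dotp h (psi q) <= b by apply: hb; exists q.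
have hs : dotp h (psi s) <= b by apply: hb; exists s.
suff : [set psi u] (psi q) by [].
rewrite hu; split; first by exists q.
move: hub; rewrite uE dotpDr !dotpZr => hub; apply/eqP; rewrite eq_le hq /=.
nra.
Qed.

(** Otherwise the one of [psi u] and [psi s] nearer to [psi q] would lie strictly between [psi q]
    and the other. *)
Lemma fixed_on_ray q s u (t : R) : fixed q -> fixed s -> fixed u ->
  s != q -> u != q -> 0 < t -> psi u - psi q = t *: (psi s - psi q) -> u = s.
Proof.
move=> fq fs fu + + t0 uE.
have between (v w : M) (a : R) : fixed v -> fixed w -> v != q -> 0 < a < 1 ->
    psi v - psi q = a *: (psi w - psi q) -> False.
  move=> fv fw vq a01 vE; move/eqP: vq; apply; apply/esym.
  apply: (fixed_not_between fq fw fv a01).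
  by apply/rowP => i; have /rowP/(_ i) := vE; rewrite !mxE; lra.
move=> sq uq; have [t1|t1|t1] := ltgtP t 1.
- by exfalso; apply: (between u s t) => //; rewrite t0.
- exfalso; apply: (between s u t^-1) => //;
  first by rewrite invr_gt0 t0 invf_lt1.
  by rewrite uE scalerA mulVf ?scale1r// gt_eqF.
- by apply: (psi_fixed_inj Hconv) => //; move: uE; rewrite t1 scale1r => /addIr.
Qed.

(* The points z_s = (psi s - psi q) / H s of the vertex figure at q lie in a
   hyperplane.  The one farthest from a point t c far away in the direction of
   -c is exposed in the vertex figure, so that it is the direction of an edge,
   and c is negative on it. *)
Lemma edge_descent q r (c : 'rV[R]_n) : fixed q -> fixed r ->
    dotp c (psi r - psi q) < 0 ->
  exists2 s, edge s q & dotp c (psi s - psi q) < 0.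
Proof.
move=> fq fr cr; have [h [b [hb hq]]] := psi_vertex Hconv fq.
have [_ hqb] : [set y | range (@psi _ _ M) y /\ dotp h y = b] (psi q) by
  rewrite -hq.
pose H s := b - dotp h (psi s).
have H0 s : fixed s -> s != q -> 0 < H s.
  move=> fs sq; rewrite lt_def subr_ge0 hb ?andbT; last by exists s.
  apply: contra sq; rewrite subr_eq0 => /eqP /esym hs; apply/eqP.
  by apply: (psi_fixed_inj Hconv) => //; suff : [set psi q] (psi s) by [];
    rewrite hq; split=> //; exists s.
pose z s := (H s)^-1 *: (psi s - psi q).
have zE s : fixed s -> s != q -> psi s - psi q = H s *: z s.
  by move=> fs sq; rewrite scalerA divff ?scale1r// gt_eqF ?H0.
have cE s : fixed s -> s != q -> (dotp c (psi s - psi q) < 0) = (dotp c (z s) <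
  0).
  by move=> fs sq; rewrite zE// dotpZr pmulr_rlt0 ?H0.
clearbody z.
have rq : r != q by apply: contraTneq cr => ->; rewrite subrr dotp0r ltxx.
pose A := [set s | fixed s /\ s != q].
have Afin : finite_set A by apply: sub_finite_set (fixed_finite Hconv) => s [].
have [s1 [fs1 s1q] s1max] := finite_argmax (fun s =>
  dotp (z s) (z s)) Afin (conj fr rq).
have zr0 : dotp c (z r) < 0 by rewrite -cE.
(* This [t] is so large that, in the maximization below, [z r] beats every point on which [c] is
   nonnegative. *)
pose t := (dotp (z s1) (z s1) + 1) / (- dotp c (z r)).
have t0 : 0 < t.
  by rewrite divr_gt0 ?oppr_gt0// ltr_wpDl ?dotp_ge0.
have tr : t * dotp c (z r) = - (dotp (z s1) (z s1) + 1).
  by rewrite /t invrN mulrN mulNr divfK// lt_eqF.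
(* Up to a constant, the maximized function is the squared distance from [t *: c]. *)
have [s [fs sq] smax] :=
  finite_argmax (fun s => dotp (z s) (z s) - 2 * (t * dotp c (z s))) Afin (conj
    fr rq).
have zs0 : dotp c (z s) < 0.
  have := smax r (conj fr rq); have := s1max s (conj fs sq).
  rewrite /= tr => h1 h2; have := dotp_ge0 (z r);
    have := dotp_ge0 (z s1) => h3 h4.
  have : t * dotp c (z s) < 0 by lra.
  by rewrite pmulr_rlt0.
exists s; last by rewrite cE.
(* All the [z u] lie in the ball around [t *: c] through [z s]. Its tangent hyperplane at [z s],
   with normal [d], touches the ball at [z s] only. *)
pose d := z s - t *: c; pose k := dotp d (z s).
have dle u : A u -> dotp (z s - z u) (z s - z u) <= 2 * (k - dotp d (z u)).
  move=> /smax /= h1; rewrite /k /d !dotpBl !dotpBr !dotpZl (dotpC (z u) (z s)).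
  lra.
(* Since [h] takes the value [- H u] on [psi u - psi q], adding [k *: h] turns the affine inequality
   on the vertex figure into a linear one on the cone at [psi q]. *)
pose L := d + k *: h.
have LE u : A u -> dotp L (psi u) - dotp L (psi q) = - (H u * (k - dotp d (z
  u))).
  move=> [fu uq]; rewrite /L -dotpBr dotpDl dotpZl {1}zE// dotpZr dotpBr hqb /H.
  ring.
have zI u : A u -> z u = z s -> u = s.
  move=> [fu uq] zus; apply: (@fixed_on_ray q s u (H u / H s)) => //.
    by rewrite divr_gt0 ?H0.
  by rewrite !zE// zus scalerA divfK// gt_eqF ?H0.
have [fA] : (forall u, fixed u -> dotp L (psi u) <= dotp L (psi q)) /\
    (forall u, fixed u -> dotp L (psi u) = dotp L (psi q) -> u = s \/ u = q).
  split=> u fu; have [->|uq] := eqVneq u q; rewrite ?lexx//; try by right.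
    rewrite -subr_le0 LE// oppr_le0; apply: mulr_ge0; first exact/ltW/H0.
    have := dle u (conj fu uq); have := dotp_ge0 (z s - z u); lra.
  move=> /eqP; rewrite -subr_eq0 LE// oppr_eq0 mulf_eq0 gt_eqF ?H0//= =>
    /eqP k0.
  left; apply: zI => //; apply/eqP; rewrite eq_sym -subr_eq0;
    apply/eqP/dotp_eq0.
  have := dle u (conj fu uq); have := dotp_ge0 (z s - z u); rewrite k0; lra.
move=> fAb; split=> //; rewrite (psi_image Hconv).
apply: (@face_segment _ _ _ L (dotp L (psi q))) => //.
- by exists s.
- by exists q.
- have : dotp L (psi s) - dotp L (psi q) = 0.
    by rewrite LE// /k subrr mulr0 oppr0.
  by move/eqP; rewrite subr_eq0 => /eqP.
- by move=> _ [u fu <-]; exact: fA.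
- by move=> _ [u fu <-] /(fAb u fu)[]->; [left|right].
Qed.

End MomentPolytope.

(** * Bases of weights and their dual bases *)

Section Weights.

(** Turns the sums and products over sets of weights or fixed points of the definitions into ones
    over the row indices of a matrix. *)
Lemma fsbig_image_fin (R : Type) (idx : R) (op : Monoid.com_law idx) (I :
  finType)
    (T : choiceType) (f : I -> T) (P : pred I) (F : T -> R) : injective f ->
  \big[op/idx]_(w \in [set w | exists2 i, P i & w = f i]) F w =
  \big[op/idx]_(i | P i) F (f i).
Proof.
move=> fI; set A := [set w | _].
have PA w : w \in map f (enum P) -> w \in A.
  by move=> /mapP[i]; rewrite mem_enum => Pi ->; apply/mem_set; exists i.
rewrite (fsbigE (map f (enum P))); first last.
- by move=> _ [i Pi ->]; rewrite mem_map// mem_enum unfold_in Pi.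
- by move=> w /= /PA /set_mem.
- by rewrite map_inj_uniq// enum_uniq.
transitivity (\big[op/idx]_(w <- map f (enum P)) F w);
  last by rewrite big_map big_enum.
rewrite big_seq_cond [RHS]big_seq; apply: eq_bigl => w.
by apply: andb_idr; exact: PA.
Qed.

Lemma finite_image_fin (I : finType) (T : choiceType) (f : I -> T)
    (P : pred I) :
  finite_set [set w | exists2 i, P i & w = f i].
Proof.
apply/finite_seqP; exists (map f (enum P)); apply/seteqP; split=> w /=.
  by move=> [i Pi ->]; rewrite map_f// mem_enum.
by move=> /mapP[i]; rewrite mem_enum => Pi ->; exists i.
Qed.

Variables (R : realType) (n : nat).
Implicit Types (A B : 'M[int]_n) (v : 'rV[R]_n) (w : 'rV[int]_n).

Lemma wRD w w' : wR R (w + w') = wR R w + wR R w'.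
Proof. by apply/rowP => i; rewrite !mxE rmorphD. Qed.

Lemma wRZ c w : wR R (c *: w) = c%:~R *: wR R w.
Proof. by apply/rowP => i; rewrite !mxE rmorphM. Qed.

(** The real dual basis of the rows of [A]: pairing with [dual A i] is the i-th coordinate in the
    basis of rows. *)
Definition dual A (i : 'I_n) : 'rV[R]_n := (col i (invmx (map_mx intr A)))^T.

Lemma dotp_dual A i v : dotp (dual A i) v = (v *m invmx (map_mx intr A)) 0 i.
Proof. by rewrite mxE; apply: eq_bigr => j _; rewrite !mxE mulrC. Qed.

Lemma map_unitmx_int A : A \in unitmx -> (map_mx intr A : 'M[R]_n) \in unitmx.
Proof.
by rewrite !unitmxE => /(rmorph_unit (intmul (1 : R))); rewrite -det_map_mx.
Qed.

Lemma wR_row A i : wR R (row i A) = row i (map_mx intr A).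
Proof. by rewrite /wR map_row. Qed.

Lemma dual_row A i j : A \in unitmx ->
  dotp (dual A i) (wR R (row j A)) = (i == j)%:R.
Proof.
move=> /map_unitmx_int AU; rewrite dotp_dual wR_row -row_mul mulmxV// !mxE.
by rewrite eq_sym.
Qed.

Lemma dual_sum A v : A \in unitmx ->
  v = \sum_i dotp (dual A i) v *: wR R (row i A).
Proof.
move=> /map_unitmx_int AU; rewrite -{1}[v](mulmxKV AU) mulmx_sum_row.
by apply: eq_bigr => i _; rewrite dotp_dual wR_row.
Qed.

Lemma row_unit_inj A : A \in unitmx -> injective (fun i => row i A).
Proof.
move=> AU i j /(congr1 (fun w => (w *m invmx A) 0 j)).
by rewrite -!row_mul mulmxV// !mxE eqxx; case: eqVneq.
Qed.

Lemma dual_rowM A B i j : A \in unitmx ->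
  dotp (dual A i) (wR R (row j B)) = ((B *m invmx A) j i)%:~R.
Proof.
move=> AU; have -> : row j B = \sum_k (B *m invmx A) j k *: row k A.
  by rewrite -{1}(mulmxKV AU B) row_mul mulmx_sum_row; apply: eq_bigr => k _;
    rewrite mxE.
rewrite (big_morph (@wR R n) wRD (id1 := 0)); last by apply/rowP => k;
  rewrite !mxE.
rewrite dotp_sumr (bigD1 i)//= big1 ?addr0 => [|k ki].
  by rewrite wRZ dotpZr dual_row// eqxx mulr1.
by rewrite wRZ dotpZr dual_row// eq_sym (negbTE ki) mulr0.
Qed.

(** For a weight matrix at [p], the direction of the affine span of the face of F_p. As a [vspace]
    it allows dimension counts. *)
Definition minus_space A (xi : 'rV[R]_n) : {vspace 'rV[R]_n} :=
  <<[seq v <- [seq wR R (row i A) | i <- enum 'I_n] | dotp v xi < 0%R]>>%VS.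

Lemma rows_free A : A \in unitmx -> free [seq wR R (row i A) | i <- enum 'I_n].
Proof.
move=> AU; set X := map _ _.
suff X1 : <<X>>%VS = fullv.
  by rewrite /free X1 dimvf dim_matrix mul1r size_map size_enum_ord.
apply/vspaceP => v; rewrite memvf.
rewrite (dual_sum v AU); apply: memv_suml => i _; apply: memvZ;
  apply: memv_span.
by apply/mapP; exists i; rewrite ?mem_enum.
Qed.

Lemma memv_minus_space A xi v : A \in unitmx ->
    (forall i, dotp (wR R (row i A)) xi != 0) ->
  v \in minus_space A xi <->
  forall i, 0 < dotp (wR R (row i A)) xi -> dotp (dual A i) v = 0.
Proof.
move=> AU gen; split=> [|v0].
  rewrite /minus_space; set X := [seq _ <- _ | _] => vX i ixi;
    rewrite (@coord_span _ _ _ (in_tuple X) _ vX) dotp_sumr big1// => k _;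
    rewrite dotpZr.
  set u := _`_k; suff -> : dotp (dual A i) u = 0 by rewrite mulr0.
  have : u \in X by exact: mem_nth.
  rewrite mem_filter => /andP[uxi /mapP[j _ uE]]; rewrite uE dual_row//.
  by case: eqVneq => // ij; move: uxi; rewrite uE -ij ltNge (ltW ixi).
rewrite (dual_sum v AU); apply: memv_suml => i _.
have [ixi|ixi|/eqP] := ltgtP (dotp (wR R (row i A)) xi) 0;
  last by rewrite (negbTE (gen i)).
  apply: memvZ; apply: memv_span; rewrite mem_filter ixi.
  by apply/mapP; exists i; rewrite ?mem_enum.
by rewrite v0// scale0r mem0v.
Qed.

Lemma row_notin_minus_space A xi j : A \in unitmx ->
    (forall i, dotp (wR R (row i A)) xi != 0) ->
  (wR R (row j A) \notin minus_space A xi) = (0 < dotp (wR R (row j A)) xi).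
Proof.
move=> AU gen; apply/idP/idP => [|jxi].
  apply: contraR => jxi; apply/memv_minus_space => // i ixi.
  by rewrite dual_row//; case: eqVneq => // ij; rewrite -ij ixi in jxi.
apply/negP => /(memv_minus_space _ AU gen) /(_ j jxi) /eqP.
by rewrite dual_row// eqxx oner_eq0.
Qed.

Lemma size_filter_rows A (P : pred 'rV[R]_n) :
  size [seq v <- [seq wR R (row i A) | i <- enum 'I_n] | P v] =
  #|[pred i | P (wR R (row i A))]|.
Proof.
by rewrite size_filter count_map -sum1_count -sum1_card big_enum_cond.
Qed.

End Weights.

(** * The flow-up *)

Section FlowUp.
Variables (R : realType) (n : nat) (M : symplectic_toric R n) (J : acs M).
Hypothesis Hconv : convexity_theorem J.
Implicit Types (p q r s u : M) (A B : 'M[int]_n).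

Definition weight_matrix q A :=
  A \in unitmx /\ weights J q = range (fun i => row i A).

Lemma weight_matrix_exists q : fixed q -> exists A, weight_matrix q A.
Proof. by move=> /(weights_basis Hconv)[A AU Aq]; exists A. Qed.

Lemma weights_row q A i : weight_matrix q A -> weights J q (row i A).
Proof. by move=> [_ ->]; exists i. Qed.

Lemma edge_weight_mem r q : edge r q -> weights J q (edge_weight r q).
Proof.
move=> e; have [_ fq _ _] := e.
exact: (set_bij_homo (weights_edges Hconv fq)).
Qed.

Lemma edge_weightE r q : edge r q ->
  exists2 m, 0 < m & psi q - psi r = m *: wR R (edge_weight r q).
Proof.
move=> e; have [_ fq _ _] := e; have [A [AU Aq]] := weight_matrix_exists fq.
(* The default value 0 of [xget] is excluded: an edge weight is a row of an invertible matrix. *)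
have := edge_weight_mem e; rewrite /edge_weight; case: xgetP => [w _ [_ //]|_].
rewrite Aq => -[i _ Ai0]; have := dual_row R i i AU; rewrite Ai0 eqxx.
rewrite (_ : wR R 0 = 0); last by apply/rowP => j; rewrite !mxE.
by rewrite dotp0r => /eqP; rewrite eq_sym oner_eq0.
Qed.

Lemma row_edge q A i : fixed q -> weight_matrix q A ->
  exists2 s, edge s q & edge_weight s q = row i A.
Proof.
move=> fq Aq; have [s] := set_bij_surj (weights_edges Hconv fq) (weights_row i
  Aq).
by exists s.
Qed.

Lemma edge_row q A r : weight_matrix q A -> edge r q ->
  exists i, edge_weight r q = row i A.
Proof. by move=> [_ Aq] /edge_weight_mem; rewrite Aq => -[i _ <-]; exists i.
Qed.

(* The moment polytope lies in the cone spanned by its edges at psi q. *)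
Lemma dual_ge0 q A i u : fixed q -> fixed u -> weight_matrix q A ->
  0 <= dotp (dual R A i) (psi q - psi u).
Proof.
move=> fq fu Aq; rewrite leNgt; apply/negP => lt0.
(* A negative coordinate at [u] would force one on some edge at [q]; but an edge is a positive
   multiple of a row of [A], with coordinates 0 or 1 up to that factor. *)
have [|s e] := @edge_descent _ _ _ _ Hconv q u (- dual R A i) fq fu.
  by rewrite -opprB dotpNr dotpNl opprK.
have [j jE] := edge_row Aq e; have [m m0 mE] := edge_weightE e.
rewrite -opprB dotpNr dotpNl opprK mE jE dotpZr dual_row; last by case: Aq.
by rewrite ltNge mulr_ge0 ?ler0n// ltW.
Qed.

Variables (xi : 'rV[R]_n).
Hypothesis Hxi : generic J xi.

Lemma generic_row q A i : fixed q -> weight_matrix q A ->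
  dotp (wR R (row i A)) xi != 0.
Proof. by move=> fq Aq; apply: Hxi.1 fq _; exact: weights_row. Qed.

Lemma wplusE q A : weight_matrix q A ->
  wplus J xi q =
  [set w | exists2 i, 0 < dotp (wR R (row i A)) xi & w = row i A].
Proof.
move=> [_ Aq]; rewrite /wplus Aq; apply/seteqP; split=> w /=.
  by move=> [[i _ <-] wxi]; exists i.
by move=> [i wxi ->]; split=> //; exists i.
Qed.

Lemma wminusE q A : weight_matrix q A ->
  wminus J xi q =
  [set w | exists2 i, dotp (wR R (row i A)) xi < 0 & w = row i A].
Proof.
move=> [_ Aq]; rewrite /wminus Aq; apply/seteqP; split=> w /=.
  by move=> [[i _ <-] wxi]; exists i.
by move=> [i wxi ->]; split=> //; exists i.
Qed.

Lemma lambdaE q A : weight_matrix q A ->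
  lambda J xi q = #|[pred i | 0 < dotp (wR R (row i A)) xi]|.
Proof.
move=> Aq; rewrite /lambda card_fset_sum1 -sum1_card.
have AI : injective (fun i => row i A) by apply: row_unit_inj; case: Aq.
rewrite -(fsbig_image_fin _ _ (fun=> 1%N) AI) (wplusE Aq) fsbig_finite//.
exact: finite_image_fin.
Qed.

Lemma Lambda_minusE q A : weight_matrix q A ->
  Lambda_minus J xi q = \prod_(i | 0 < dotp (wR R (row i A)) xi) lin (row i A).
Proof.
move=> Aq; rewrite /Lambda_minus (wplusE Aq).
by rewrite fsbig_image_fin//; apply: row_unit_inj; case: Aq.
Qed.

Variables (p : M) (B : 'M[int]_n).
Hypotheses (fp : fixed p) (Bp : weight_matrix p B).
Local Notation U := (minus_space B xi).

Lemma flow_upE q : flow_up J xi p q <-> psi q - psi p \in U.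
Proof.
have BU : B \in unitmx by case: Bp.
have gen i := generic_row i fp Bp.
have sumE (c : 'rV[int]_n -> R) : \sum_(w \in wminus J xi p) c w *: wR R w =
    \sum_(i | dotp (wR R (row i B)) xi < 0) c (row i B) *: wR R (row i B).
  rewrite (wminusE Bp) (@fsbig_image_fin _ _ _ _ _ (fun i => row i B))//.
  exact: row_unit_inj.
split=> [[c ->]|/(memv_minus_space _ BU gen) qU].
  rewrite addrC addKr sumE; apply: memv_suml => i ixi; apply: memvZ;
    apply: memv_span.
  by rewrite mem_filter ixi; apply/mapP; exists i; rewrite ?mem_enum.
(* The coefficients have to be indexed by weights; the rows being distinct, each sum has at most one
   term. *)
exists (fun w => \sum_(i | row i B == w) dotp (dual R B i) (psi q - psi p)).
apply/eqP; rewrite addrC -subr_eq; apply/eqP; rewrite sumE [LHS](dual_sum _ BU).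
rewrite (bigID (fun i => dotp (wR R (row i B)) xi < 0)) /= [X in _ + X]big1
  ?addr0.
  apply: eq_bigr => i _; rewrite (big_pred1 i)// => j /=.
  by rewrite (inj_eq (row_unit_inj BU)).
move=> i; rewrite -leNgt le_eqVlt eq_sym (negbTE (gen i)) /= => /qU ->.
by rewrite scale0r.
Qed.

Lemma flow_up_refl : flow_up J xi p p.
Proof. by rewrite flow_upE subrr mem0v. Qed.

Lemma flow_up_diff q u : flow_up J xi p q ->
  flow_up J xi p u <-> psi q - psi u \in U.
Proof.
move=> /flow_upE qU; rewrite flow_upE; split=> uU.
  have -> : psi q - psi u = psi q - psi p - (psi u - psi p) by rewrite opprB
    addrA subrK.
  exact: memvB.
have -> : psi u - psi p = psi q - psi p - (psi q - psi u).
  by rewrite opprB [RHS]addrC addrA subrK.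
exact: memvB.
Qed.

(* F_p is a face: the functional g vanishes on F_p and is positive on the other
   fixed points. *)
Lemma flow_up_face q u A j : fixed q -> fixed u -> weight_matrix q A ->
    flow_up J xi p q -> flow_up J xi p u ->
  dotp (dual R A j) (psi q - psi u) = 0 \/ wR R (row j A) \in U.
Proof.
move=> fq fu Aq Fq Fu; have [AU _] := Aq; have [BU _] := Bp.
have gen i := generic_row i fp Bp.
pose g := \sum_(i | 0 < dotp (wR R (row i B)) xi) dual R B i.
have gE v : dotp g v = \sum_(i | 0 < dotp (wR R (row i B)) xi) dotp (dual R B
  i) v.
  by rewrite dotpC dotp_sumr; apply: eq_bigr => i _; rewrite dotpC.
have gU v : v \in U -> dotp g v = 0.
  by move=> /(memv_minus_space _ BU gen) vU; rewrite gE big1.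
have gdiff s : dotp g (psi q - psi s) = dotp g (psi p - psi s).
  have -> : psi q - psi s = psi q - psi p + (psi p - psi s) by rewrite addrA
    subrK.
  by rewrite dotpDr (gU (psi q - psi p)) ?add0r -?flow_upE.
have neighbor k : exists s m, [/\ edge s q,
  0 < m & psi q - psi s = m *: wR R (row k A)].
  have [s e sE] := row_edge k fq Aq; have [m m0 mE] := edge_weightE e.
  by exists s, m; rewrite -sE.
have g_row k : 0 <= dotp g (wR R (row k A)).
  have [s [m [e m0 mE]]] := neighbor k; have [fs _ _ _] := e.
  rewrite -(pmulr_rge0 _ m0) -dotpZr -mE gdiff gE.
  by apply: sumr_ge0 => i _; exact: dual_ge0.
(* [g] vanishes on [psi q - psi u], and both factors of each term are nonnegative, so each term is
   0. *)
have /eqP : \sum_k dotp (dual R A k) (psi q - psi u) * dotp g (wR R (row k A))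
  = 0.
  rewrite -[RHS](gU (psi q - psi u)); last exact/flow_up_diff.
  rewrite [in RHS](dual_sum (psi q - psi u) AU) dotp_sumr.
  by apply: eq_bigr => k _; rewrite dotpZr.
rewrite psumr_eq0 => [/allP /(_ j (mem_index_enum _))|k _]; last first.
  by rewrite mulr_ge0// dual_ge0.
rewrite /= mulf_eq0 => /orP[/eqP|/eqP gj]; first by left.
(* Here [g] vanishes on the j-th edge at [q]. Its other end [s] then has all its positive-weight
   coordinates at [p] equal to 0, that is, lies in F_p. *)
right; have [s [m [e m0 mE]]] := neighbor j; have [fs _ _ _] := e.
suff : psi q - psi s \in U.
  by rewrite mE rpredZeq gt_eqF.
apply/(flow_up_diff _ Fq)/flow_upE; rewrite -memvN opprB.
apply/(memv_minus_space _ BU gen) => i ixi.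
have /eqP : dotp g (psi p - psi s) = 0.
  by rewrite -gdiff mE dotpZr gj mulr0.
rewrite gE psumr_eq0 => [/allP /(_ i (mem_index_enum _))|k _];
  last exact: dual_ge0.
by rewrite ixi => /eqP.
Qed.


Lemma flow_up_diff_span q u A : fixed q -> fixed u -> weight_matrix q A ->
    flow_up J xi p q -> flow_up J xi p u ->
  psi q - psi u \in <<[seq v <- [seq wR R (row i A) | i <- enum 'I_n] | v \in
    U]>>%VS.
Proof.
move=> fq fu Aq Fq Fu; have [AU _] := Aq.
rewrite (dual_sum (psi q - psi u) AU); apply: memv_suml => i _.
have [->|iU] := flow_up_face i fq fu Aq Fq Fu; first by rewrite scale0r mem0v.
apply: memvZ; apply: memv_span; rewrite mem_filter iU.
by apply/mapP; exists i; rewrite ?mem_enum.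
Qed.

(** The rows of [A] lying in [U] span [U], so there are as many of them as elements of W_p^-; the
    others number lambda_p. *)
Lemma card_normal_weights q A : fixed q -> weight_matrix q A ->
    flow_up J xi p q ->
  #|[pred j | wR R (row j A) \notin U]| = lambda J xi p.
Proof.
move=> fq Aq Fq; have [AU _] := Aq; have [BU _] := Bp.
set X := [seq v <- [seq wR R (row i A) | i <- enum 'I_n] | v \in U].
have XU : <<X>>%VS = U.
  apply/eqP; rewrite eqEsubv; apply/andP; split.
    by apply/span_subvP => v; rewrite mem_filter => /andP[].
  (* A weight of W_p^- belongs to an edge from [p] to a vertex [s] of F_p, and [psi p - psi s] is a
     difference of two vectors based at [psi q]. *)
  apply/span_subvP => v; rewrite mem_filter => /andP[vxi /mapP[i _ vE]].
  have [s e sE] := row_edge i fp Bp; have [m m0 mE] := edge_weightE e.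
  have [fs _ _ _] := e; rewrite sE -vE in mE.
  suff : psi p - psi s \in <<X>>%VS by rewrite mE rpredZeq gt_eqF.
  have Fs : flow_up J xi p s.
    apply/(flow_up_diff _ flow_up_refl); rewrite mE; apply: memvZ;
      apply: memv_span.
    by rewrite mem_filter vxi vE; apply/mapP; exists i; rewrite ?mem_enum.
  have -> : psi p - psi s = psi q - psi s - (psi q - psi p).
    by rewrite opprB [RHS]addrC addrA subrK.
  by apply: memvB; apply: flow_up_diff_span => //; exact: flow_up_refl.
have cardX : #|[pred j | wR R (row j A) \in U]| =
    #|[pred i | dotp (wR R (row i B)) xi < 0]|.
  have /eqP := filter_free (mem U) (rows_free R AU).
  rewrite -/X XU (size_filter_rows _ (mem U)) => <-.
  have /eqP -> := filter_free (fun v => dotp v xi < 0) (rows_free R BU).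
  by rewrite size_filter_rows.
rewrite (lambdaE Bp); apply/eqP.
rewrite -(eqn_add2l #|[pred j | wR R (row j A) \in U]|) (cardC (fun j =>
  wR R (row j A) \in U)).
rewrite cardX -(cardC [pred i | dotp (wR R (row i B)) xi < 0]) eqn_add2l.
apply/eqP/eq_card => i; rewrite !inE -leNgt le_eqVlt.
by rewrite eq_sym (negbTE (generic_row i fp Bp)).
Qed.

Lemma mu_diff q u : mu xi q - mu xi u = dotp xi (psi q - psi u).
Proof. by rewrite /mu -dotpBl dotpC. Qed.

(** [psi p - psi q] is a combination of weights of W_p^- with nonnegative coefficients. *)
Lemma mu_flow_up q : fixed q -> flow_up J xi p q -> mu xi p <= mu xi q.
Proof.
move=> fq Fq; have [BU _] := Bp; have gen i := generic_row i fp Bp.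
have /(memv_minus_space _ BU gen) qU : psi p - psi q \in U.
  exact/(flow_up_diff _ flow_up_refl).
rewrite -subr_le0 mu_diff (dual_sum (psi p - psi q) BU) dotp_sumr.
apply: sumr_le0 => i _; rewrite dotpZr [dotp xi _]dotpC.
have [ixi|ixi] := leP (dotp (wR R (row i B)) xi) 0.
  by rewrite mulr_ge0_le0// dual_ge0.
by rewrite qU// mul0r.
Qed.

(** [psi q - psi p] is a nonnegative combination of the weights at [q] lying in [U], and [xi] is
    positive on it by genericity, hence on one of these weights. *)
Lemma flow_up_descent q A : fixed q -> weight_matrix q A -> flow_up J xi p q ->
    q <> p ->
  exists2 j, wR R (row j A) \in U & 0 < dotp (wR R (row j A)) xi.
Proof.
move=> fq Aq Fq qp; have [AU _] := Aq; apply: contrapT => noj.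
have : mu xi p < mu xi q.
  rewrite lt_neqAle mu_flow_up// andbT; apply/eqP => pq.
  by apply: qp; apply: Hxi.2.
apply/negP; rewrite -leNgt -subr_le0 mu_diff (dual_sum (psi q - psi p) AU)
  dotp_sumr.
apply: sumr_le0 => j _; rewrite dotpZr [dotp xi _]dotpC.
have [->|jU] := flow_up_face j fq fp Aq Fq flow_up_refl; first by rewrite mul0r.
rewrite mulr_ge0_le0 ?dual_ge0// leNgt; apply/negP => jxi.
by apply: noj; exists j.
Qed.

(** An edge at [q] leaves F_p exactly when its weight is outside [U]. *)
Lemma normal_eulerE q A : fixed q -> weight_matrix q A -> flow_up J xi p q ->
  normal_euler J xi p q = \prod_(j | wR R (row j A) \notin U) lin (row j A).
Proof.
move=> fq Aq Fq; have [AU _] := Aq.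
have rU r : edge r q -> flow_up J xi p r <-> wR R (edge_weight r q) \in U.
  move=> e; have [m m0 mE] := edge_weightE e; have [fr _ _ _] := e.
  by rewrite (flow_up_diff r Fq) mE rpredZeq gt_eqF.
rewrite /normal_euler -(fsbig_image_fin _ _ (@lin n) (row_unit_inj AU)).
apply/esym/reindex_fsbig; split=> [r [fr Fr e]|r s|_ [j jU ->]].
- have [j jE] := edge_row Aq e; exists j => //.
  by rewrite -jE; apply/negP => /(rU r e).
- rewrite !inE => -[_ _ er] [_ _ es];
  apply: (set_bij_inj (weights_edges Hconv fq)).
    exact/mem_set.
  exact/mem_set.
- have [s e sE] := row_edge j fq Aq; have [fs _ _ _] := e.
  by exists s => //; split=> // /(rU s e); rewrite sE; apply/negP.
Qed.

End FlowUp.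

(** * Connection along the edges *)

Section Connection.

(* Nonnegative integer matrices that are inverse to each other are permutation
   matrices; here up to one row and one column. *)
Lemma nonneg_inverse n (N N' : 'M[int]_n) i0 j0 :
    N *m N' = 1%:M -> N' *m N = 1%:M ->
    (forall j i, i != i0 -> 0 <= N j i) ->
    (forall i j, j != j0 -> 0 <= N' i j) ->
    (forall i, i != i0 -> N j0 i = 0) -> (forall j, j != j0 -> N' i0 j = 0) ->
  forall j, j != j0 -> exists i, [/\ i != i0, N j i = 1 &
    forall k, k != i -> k != i0 -> N j k = 0].
Proof.
move=> NN' N'N N0 N'0 Nj0 N'i0 j jj0.
have [i Nji] : exists i, N j i * N' i j != 0.
  apply: contrapT => noi; have := congr1 (fun A : 'M[int]_n => A j j) NN'.
  rewrite !mxE eqxx big1 // => i _; apply/eqP; apply: contrapT => /negP ni.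
  by apply: noi; exists i.
have ii0 : i != i0 by apply: contraNneq Nji => ->; rewrite N'i0// mulr0.
have Nji0 : 0 < N j i.
  by rewrite lt_def N0// andbT; apply: contraNneq Nji => ->; rewrite mul0r.
have N'ij0 : 0 < N' i j.
  by rewrite lt_def N'0// andbT; apply: contraNneq Nji => ->; rewrite mulr0.
(* Row [i] of the product is thus a sum of nonnegative terms off the column [i0]: its diagonal entry
   1 bounds [N j i] by 1, and its zero entries kill the rest of row [j] of [N]. *)
have N'N_ge0 k l : k != i0 -> 0 <= N' i l * N l k.
  move=> ki0; have [->|lj0] := eqVneq l j0; first by rewrite Nj0// mulr0.
  by rewrite mulr_ge0// ?N0 ?N'0.
have N'N1 k : \sum_l N' i l * N l k = (i == k)%:R.
  by have := congr1 (fun A : 'M[int]_n => A i k) N'N; rewrite !mxE.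
exists i; split=> // [|k ki ki0].
  have : N' i j * N j i <= 1.
    have := N'N1 i; rewrite eqxx (bigD1 j)//= => N'N1i;
      rewrite -[leRHS]N'N1i lerDl.
    by apply: sumr_ge0 => l _; exact: N'N_ge0.
  move=> le1; apply/le_anti; rewrite -[1 <= _]gtz0_ge1 Nji0 andbT (le_trans _
    le1)//.
  by apply: ler_peMl; [exact: ltW | rewrite -gtz0_ge1].
have /eqP := N'N1 k; rewrite [i == k]eq_sym (negbTE ki) psumr_eq0 => [|l _];
  last exact: N'N_ge0.
move=> /allP /(_ j (mem_index_enum _)) /=.
by rewrite mulf_eq0 gt_eqF//= => /eqP.
Qed.

Variables (R : realType) (n : nat) (M : symplectic_toric R n) (J : acs M).
Hypothesis Hconv : convexity_theorem J.
Implicit Types (p q r s u : M) (A B : 'M[int]_n).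

Lemma edge_sym r q : edge r q -> edge q r.
Proof.
move=> [fr fq rq e]; split; rewrite // 1?eq_sym//.
rewrite (_ : segment _ _ = segment (psi r) (psi q))//.
apply/seteqP; split=> _ [t [t0 t1 ->]]; exists (1 - t);
  by rewrite subr_ge0 gerBl subKr addrC.
Qed.

(** The j-th edge at [r] ends at a vertex [s], whose i-th coordinate at [q] is nonnegative; the edge
    from [r] to [q] does not contribute to this coordinate. *)
Lemma connection_ge0 r q A A' i0 i j : weight_matrix J q A ->
  weight_matrix J r A' ->
  edge r q -> edge_weight r q = row i0 A -> i != i0 -> 0 <= (A' *m invmx A) j i.
Proof.
move=> Aq Ar e i0E ii0; have [AU _] := Aq; have [fr fq _ _] := e.
have [s es sE] := row_edge Hconv j fr Ar;
  have [m m0 mE] := edge_weightE Hconv es.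
have [k k0 kE] := edge_weightE Hconv e; have [fs _ _ _] := es.
have := dual_ge0 Hconv i fq fs Aq.
have -> : psi q - psi s = psi q - psi r + (psi r - psi s) by rewrite addrA
  subrK.
rewrite mE kE sE i0E dotpDr !dotpZr dual_row// (negbTE ii0) mulr0 add0r
  dual_rowM//.
by rewrite pmulr_rge0// ler0z.
Qed.

Lemma connection_eq0 r q A A' i0 i j0 : weight_matrix J q A ->
  weight_matrix J r A' ->
  edge r q -> edge_weight r q = row i0 A -> edge_weight q r = row j0 A' ->
  i != i0 -> (A' *m invmx A) j0 i = 0.
Proof.
move=> Aq Ar e i0E j0E ii0; have [AU _] := Aq.
have [k k0 kE] := edge_weightE Hconv e.
have [m m0 mE] := edge_weightE Hconv (edge_sym e).
apply/eqP; rewrite -(intr_eq0 R) -dual_rowM// -j0E.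
rewrite -(inj_eq (mulfI (lt0r_neq0 m0))) mulr0 -dotpZr -mE -opprB dotpNr kE i0E.
by rewrite dotpZr dual_row// (negbTE ii0) mulr0 oppr0.
Qed.

Lemma row_mulmxKV A A' j : A \in unitmx ->
  row j A' = \sum_i (A' *m invmx A) j i *: row i A.
Proof.
move=> AU; rewrite -{1}(mulmxKV AU A') row_mul mulmx_sum_row.
by apply: eq_bigr => i _; rewrite mxE.
Qed.

Lemma opposite_edge_weight r q A A' i0 j0 : weight_matrix J q A ->
  weight_matrix J r A' -> edge r q ->
  edge_weight r q = row i0 A -> edge_weight q r = row j0 A' ->
  row j0 A' = (A' *m invmx A) j0 i0 *: row i0 A.
Proof.
move=> Aq Ar e i0E j0E; have [AU _] := Aq.
rewrite {1}(row_mulmxKV A' j0 AU) (bigD1 i0)//= big1 ?addr0// => i ii0.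
by rewrite (connection_eq0 Aq Ar e i0E j0E ii0) scale0r.
Qed.

(* The weights at the two ends of an edge agree modulo the weight of the edge:
   the images of the two cones in the quotient by the edge coincide, since both
   are generated by the image of the moment polytope. *)
Lemma edge_connection r q A A' i0 j0 : weight_matrix J q A ->
  weight_matrix J r A' -> edge r q ->
  edge_weight r q = row i0 A -> edge_weight q r = row j0 A' ->
  exists f : 'I_n -> 'I_n, [/\ injective f, f j0 = i0 &
    forall j, j != j0 -> exists b : int,
      row j A' = row (f j) A + b *: row i0 A].
Proof.
move=> Aq Ar e i0E j0E; have [AU _] := Aq; have [AU' _] := Ar.
have step j : exists i, (j = j0 -> i = i0) /\
    (j != j0 -> i != i0 /\ exists b : int, row j A' = row i A + b *: row i0 A).
  have [->|jj0] := eqVneq j j0; first by exists i0.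
  have NN' : A' *m invmx A *m (A *m invmx A') = 1%:M by rewrite mulmxA
    mulmxKV// mulmxV.
  have N'N : A *m invmx A' *m (A' *m invmx A) = 1%:M by rewrite mulmxA
    mulmxKV// mulmxV.
  have e' := edge_sym e.
  have [i [ii0 Nji Njk]] := nonneg_inverse NN' N'N
    (fun j i => connection_ge0 j Aq Ar e i0E)
    (fun i j => connection_ge0 i Ar Aq e' j0E)
    (fun i => connection_eq0 Aq Ar e i0E j0E)
    (fun j => connection_eq0 Ar Aq e' j0E i0E) jj0.
  exists i; split=> [jj|_]; first by rewrite jj eqxx in jj0.
  split=> //; exists ((A' *m invmx A) j i0).
  rewrite {1}(row_mulmxKV A' j AU) (bigD1 i)//= Nji scale1r (bigD1 i0)/=
    1?eq_sym//.
  by rewrite big1 ?addr0// => k /andP[ki ki0]; rewrite Njk ?scale0r.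
have [f fP] := choice step; exists f.
have fj0 : f j0 = i0 by have [->] := fP j0.
split=> // [j k fjk|j jj0]; last by have [_ /(_ jj0)[]] := fP j.
have [jj0|jj0] := eqVneq j j0; have [kj0|kj0] := eqVneq k j0;
  first by rewrite jj0.
- by have [_ /(_ kj0)[]] := fP k; rewrite -fjk jj0 fj0 eqxx.
- by have [_ /(_ jj0)[]] := fP j; rewrite fjk kj0 fj0 eqxx.
have [_ /(_ jj0)[_ [b bE]]] := fP j; have [_ /(_ kj0)[_ [c cE]]] := fP k.
apply/eqP; apply: contraT => jk.
(* The coordinate [D] vanishes on the weight of the edge, so it would take the same value on the
   rows [j] and [k] of [A']. *)
pose D v := dotp (dual R A' j) (wR R v).
have DE v i b' : D (v + b' *: row i A) = D v + b'%:~R * D (row i A).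
  by rewrite /D wRD wRZ dotpDr dotpZr.
have Di0 : D (row i0 A) = 0.
  rewrite (opposite_edge_weight Ar Aq (edge_sym e) j0E i0E) /D wRZ dotpZr
    dual_row//.
  by rewrite (negbTE jj0) mulr0.
have : D (row j A') = D (row k A') by rewrite bE cE !DE Di0 !mulr0 fjk.
by rewrite /D !dual_row// eqxx (negbTE jk) => /eqP; rewrite oner_eq0.
Qed.


Lemma prod_congr (I : finType) (P : pred I) (F G : I -> zpoly n) (e : zpoly n) :
    (forall i, P i -> exists g, F i - G i = e * g) ->
  exists g, \prod_(i | P i) F i - \prod_(i | P i) G i = e * g.
Proof.
move=> FG; elim/big_rec2: _ => [|i a b Pi [g gE]]; first by exists 0;
  rewrite subrr mulr0.
have [h hE] := FG i Pi; exists (h * b + G i * g).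
have -> : F i = G i + e * h by rewrite -hE addrC subrK.
have -> : b = a + e * g by rewrite -gE addrC subrK.
by ring.
Qed.

Variables (xi : 'rV[R]_n).
Hypothesis Hxi : generic J xi.

(** The restrictions prescribed for eta_p, gathered in one function; both classes are shown to have
    these restrictions. *)
Definition dual_restriction p q : zpoly n :=
  if `[< flow_up J xi p q >] then normal_euler J xi p q else 0.

(** If both ends lie in F_p, the connection matches the normal weights modulo the weight of the
    edge. If only one does, the edge is normal there and its weight is a factor, up to an integer
    multiple. *)
Lemma dual_restriction_edge p r q : fixed p -> edge r q ->
  exists g, dual_restriction p q - dual_restriction p r = lin (edge_weight r q)
    * g.
Proof.
move=> fp e; have [B Bp] := weight_matrix_exists Hconv fp.
have [fr fq _ _] := e; have e' := edge_sym e.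
have [A Aq] := weight_matrix_exists Hconv fq.
have [A' Ar] := weight_matrix_exists Hconv fr.
have [i0 i0E] := edge_row Hconv Aq e; have [j0 j0E] := edge_row Hconv Ar e'.
have eE := opposite_edge_weight Aq Ar e i0E j0E.
pose U := minus_space B xi.
have [m m0 mE] := edge_weightE Hconv e; rewrite i0E in mE *.
have FU (u v : M) : flow_up J xi p u ->
  flow_up J xi p v <-> psi u - psi v \in U.
  exact: (flow_up_diff Hxi fp Bp).
have eulerE (u : M) (C : 'M[int]_n) : fixed u -> weight_matrix J u C ->
  flow_up J xi p u ->
    dual_restriction p u = \prod_(j | wR R (row j C) \notin U) lin (row j C).
  move=> fu Cu Fu; rewrite /dual_restriction asboolT//.
  exact: (normal_eulerE Hconv Hxi fp Bp).
have restr0 (u : M) : ~ flow_up J xi p u -> dual_restriction p u = 0.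
  by move=> Fu; rewrite /dual_restriction asboolF.
have [Fq|Fq] := pselect (flow_up J xi p q);
  have [Fr|Fr] := pselect (flow_up J xi p r).
- have i0U : wR R (row i0 A) \in U.
    by have /(FU q r Fq) := Fr; rewrite mE rpredZeq gt_eqF.
  have j0U : wR R (row j0 A') \in U by rewrite eE wRZ memvZ.
  have [f [fI fj0 fE]] := edge_connection Aq Ar e i0E j0E.
  rewrite (eulerE q A)// (eulerE r A')// (reindex_inj fI) /=.
  rewrite (eq_bigl (fun j => wR R (row j A') \notin U)) => [|j]; last first.
    have [->|jj0] := eqVneq j j0; first by rewrite fj0 i0U j0U.
    have [b ->] := fE j jj0; rewrite wRD wRZ; congr (~~ _).
    by rewrite rpredDr// memvZ.
  apply: prod_congr => j jU; have jj0 : j != j0 by apply: contraNneq jU => ->.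
  have [b ->] := fE j jj0; exists (- b%:~R).
  by rewrite linD linZ mulrN mulrzr opprD addrA subrr add0r.
- rewrite (eulerE q A)// (restr0 r)// subr0.
  have i0U : wR R (row i0 A) \notin U.
    by apply/negP => i0U; apply: Fr; apply/(FU q r Fq); rewrite mE memvZ.
  by rewrite (bigD1 i0)//=; eexists.
- rewrite (restr0 q)// (eulerE r A')// sub0r.
  have [m' m'0 m'E] := edge_weightE Hconv e'.
  have j0U : wR R (row j0 A') \notin U.
    by apply/negP => j0U; apply: Fq; apply/(FU r q Fr); rewrite m'E j0E memvZ.
  rewrite (bigD1 j0)//= eE linZ.
  by rewrite -mulrzl -mulrA mulrCA -mulrN; eexists.
- by rewrite !restr0// subrr; exists 0; rewrite mulr0.
Qed.

End Connection.

(** * Existence and uniqueness of the i-canonical class *)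

Section CanonicalClasses.
Variables (R : realType) (n : nat) (M : symplectic_toric R n) (J : acs M).
Variable x : 'I_n -> cochain R (BT R n).
Hypothesis Hconv : convexity_theorem J.
Hypothesis Hloc : localization_theorem M x.
Implicit Types (p q r s u : M) (A B : 'M[int]_n) (tau : cochain R (MT M)).

Lemma restricts_inj tau q f g : restricts x tau q f -> restricts x tau q g ->
  f = g.
Proof.
move=> tf tg; apply: (point_inj Hloc).
by apply: cohomologous_trans tg; exact: cohomologous_sym.
Qed.

Lemma restricts_degree_part tau q f d : (forall j, pure 2 (x j)) ->
  f \is homog d -> restricts x tau q f ->
    restricts x (degree_part d.*2 tau) q f.
Proof.
by move=> x2 fd; move/cohomologous_degree_part; apply; exact: pure_cup_eval.
Qed.

Variable xi : 'rV[R]_n.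
Hypothesis Hxi : generic J xi.

Lemma adapted_weight_matrix q w : fixed q -> adapted_basis J xi q w ->
  weight_matrix J q (\matrix_i w i).
Proof.
move=> fq [_ wq _]; have [A [AU Aq]] := weight_matrix_exists Hconv fq; split.
  have wA i : exists j, w j = row i A.
    by have : weights J q (row i A); [rewrite Aq;
      exists i | rewrite -wq => -[j _ <-]; exists j].
  have [f fE] := choice wA; move: AU.
  (* The invertible [A] factors through the matrix of the [w i], which is therefore invertible. *)
  have -> : A = rowsub f (\matrix_i w i).
    by apply/row_matrixP => i; rewrite row_rowsub rowK fE.
  by rewrite rowsubE unitmx_mul => /andP[].
by rewrite -wq; apply: eq_imagel => i _; rewrite rowK.
Qed.

Lemma adapted_basis_exists q : fixed q -> exists w, adapted_basis J xi q w.
Proof.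
move=> fq; have [A Aq] := weight_matrix_exists Hconv fq; have [AU AE] := Aq.
pose P (v : 'rV[int]_n) := 0 < dotp (wR R v) xi.
pose L := [seq row i A | i <- enum 'I_n].
pose L1 := [seq v <- L | P v]; pose L2 := [seq v <- L | ~~ P v].
have Lperm : perm_eq (L1 ++ L2) L by rewrite perm_filterC.
have sL : size (L1 ++ L2) = n by rewrite (perm_size Lperm) size_map
  size_enum_ord.
have uL : uniq (L1 ++ L2).
  by rewrite (perm_uniq Lperm) map_inj_uniq ?enum_uniq//; exact: row_unit_inj.
have LE v : v \in L <-> weights J q v.
  rewrite AE; split=> [/mapP[i _ ->]|[i _ <-]]; first by exists i.
  by apply/mapP; exists i; rewrite ?mem_enum.
have sL1 : size L1 = lambda J xi q.
  rewrite (lambdaE xi Aq) size_filter count_map -sum1_count -sum1_card.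
  by rewrite big_enum_cond.
exists (fun i => nth 0 (L1 ++ L2) i); split.
- by move=> i j /eqP; rewrite nth_uniq ?sL// => /eqP /val_inj.
- apply/seteqP; split=> [_ [i _ <-]|v /LE].
    by apply/LE; rewrite -(perm_mem Lperm) mem_nth ?sL.
  rewrite -(perm_mem Lperm) => vL.
  have vn : (index v (L1 ++ L2) < n)%N by rewrite -[X in (_ < X)%N]sL index_mem.
  by exists (Ordinal vn) => //=; rewrite nth_index.
move=> i; rewrite -sL1 nth_cat; split=> [[_]|iL1].
  apply: contraTT => iL1; rewrite (negbTE iL1) -/(P _).
  have : nth 0 L2 (i - size L1) \in L2.
    by apply: mem_nth; rewrite ltn_subLR -?size_cat ?sL// leqNgt.
  by rewrite mem_filter => /andP[].
rewrite iL1; have := mem_nth 0 iL1; rewrite mem_filter => /andP[? ?].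
by split=> //; apply/LE.
Qed.

Lemma dual_restriction_homog p q : fixed p -> fixed q ->
  dual_restriction J xi p q \is homog (lambda J xi p).
Proof.
move=> fp fq; rewrite /dual_restriction; case: asboolP => Fq;
  last exact: mpoly.dhomog0.
have [B Bp] := weight_matrix_exists Hconv fp.
have [A Aq] := weight_matrix_exists Hconv fq.
rewrite (normal_eulerE Hconv Hxi fp Bp fq Aq Fq).
rewrite -(card_normal_weights Hconv Hxi fp Bp fq Aq Fq).
exact: prod_lin_homog.
Qed.

Lemma normal_euler_self p : fixed p ->
  normal_euler J xi p p = Lambda_minus J xi p.
Proof.
move=> fp; have [B Bp] := weight_matrix_exists Hconv fp.
have Fp := flow_up_refl Hxi fp Bp; have [BU _] := Bp.
rewrite (normal_eulerE Hconv Hxi fp Bp fp Bp Fp) (Lambda_minusE xi Bp).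
by apply: eq_bigl => j; apply: row_notin_minus_space => // i;
  exact: (generic_row Hxi i fp Bp).
Qed.

(** Off F_p the polynomial is 0. At [p] it is the product of the first lambda variables. Elsewhere
    on F_p one of these variables is missing from the product, and the integral vanishes. *)
Lemma dual_restriction_integral p q w : fixed p -> fixed q ->
    adapted_basis J xi q w ->
  exists f, subst f (fun i => lin (w i)) = dual_restriction J xi p q /\
    integral_CP (lambda J xi q) f = (q == p)%:R.
Proof.
move=> fp fq wq; have [B Bp] := weight_matrix_exists Hconv fp;
  have [BU _] := Bp.
have Aq := adapted_weight_matrix fq wq.
rewrite /dual_restriction; case: asboolP => Fq; last first.
  exists 0; rewrite subst0 integral_CP_0; split=> //; case: eqP => // qp.
  by case: Fq; rewrite qp; exact: (flow_up_refl Hxi fp Bp).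
pose K := [pred j : 'I_n | wR R (w j) \notin minus_space B xi].
exists (\prod_(j | K j) var j); split.
  rewrite (normal_eulerE Hconv Hxi fp Bp fq Aq Fq) subst_prod.
  by apply: eq_big => [j|j _]; rewrite ?substX rowK.
have wplusP j : 0 < dotp (wR R (w j)) xi <-> (j < lambda J xi q)%N.
  case: wq => _ wE <-; rewrite /wplus /=; split=> [|[]//].
  by split=> //; rewrite -wE; exists j.
case: eqP => [qp|qp].
  rewrite (eq_bigl (fun j : 'I_n => (j < lambda J xi q)%N)) => [|j].
    exact: integral_CP_euler.
  have [k wk] : exists k, w j = row k B.
    have [_ BE] := Bp; have [_ wE _] := wq.
    have : weights J q (w j) by rewrite -wE; exists j.
    by rewrite qp BE => -[k _ <-]; exists k.
  rewrite /K /= wk row_notin_minus_space// -?wk => [|i];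
    last exact: (generic_row Hxi i fp Bp).
  by apply/idP/idP => /wplusP.
have [j jU jxi] := flow_up_descent Hconv Hxi fp Bp fq Aq Fq qp.
rewrite rowK in jU jxi; apply: (integral_CP_prod_eq0 (j := j));
  first exact/wplusP.
by rewrite /K /= negbK.
Qed.

Lemma dual_restriction_i_canonical p tau : fixed p -> cocycle tau ->
    (forall q, fixed q -> restricts x tau q (dual_restriction J xi p q)) ->
  i_canonical x J xi p tau.
Proof.
move=> fp ctau tauE; have [B Bp] := weight_matrix_exists Hconv fp.
have index q : fixed q -> local_index x J xi q tau (q == p)%:R.
  move=> fq; have [w wq] := adapted_basis_exists fq.
  have [f [fE f_int]] := dual_restriction_integral fp fq wq.
  exists w, f, (q == p)%:R; split=> //; first by rewrite fE; exact: tauE.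
    by rewrite f_int; case: eqP; rewrite ?rmorph1 ?rmorph0.
  by case: eqP; rewrite ?subst1 ?subst0.
split; last 2 first.
- by have := index p fp; rewrite eqxx.
- by move=> q fq /eqP qp; have := index q fq; rewrite (negbTE qp).
split=> //.
  have := tauE p fp; rewrite /dual_restriction asboolT ?normal_euler_self//.
  exact: (flow_up_refl Hxi fp Bp).
move=> q fq qp; have := tauE q fq; rewrite /dual_restriction asboolF// => Fq.
by move: qp; rewrite ltNge (mu_flow_up Hconv Hxi fp Bp).
Qed.

Lemma i_canonical_restriction p tau : fixed p -> i_canonical x J xi p tau ->
  forall q, fixed q -> restricts x tau q (dual_restriction J xi p q).
Proof.
move=> fp [[ctau _ _] indp indq].
pose G := dual_restriction J xi p.
have index q : fixed q -> local_index x J xi q tau (q == p)%:R.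
  by move=> fq; case: eqP => [->//|qp]; exact: indq.
have [F FE] : exists F, forall q, fixed q -> restricts x tau q (F q).
  suff /choice[F FE] : forall q, exists f,
    fixed q -> restricts x tau q f by exists F.
  move=> q; have [fq|] := pselect (fixed q); last by exists 0.
  by have [w [f [h [_ fr _ _]]]] := index q fq; eexists=> _; exact: fr.
have Fgkm : forall r q, edge r q -> exists g,
  F q - F r = lin (edge_weight r q) * g.
  by apply/(restriction_image Hloc); exists tau.
suff FG q : fixed q -> F q = G q by move=> q fq; rewrite -/(G q) -FG//;
  exact: FE.
move=> fq; apply: contrapT => qFG.
have bad_fin : finite_set [set u | fixed u /\ F u <> G u].
  by apply: sub_finite_set (fixed_finite Hconv) => u [].
(* Maximizing [- mu] selects the lowest fixed point at which the restrictions differ. *)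
have {q fq qFG} [q [fq qFG] qmin] :=
  finite_argmax (fun u => - mu xi u) bad_fin (conj fq qFG).
have FG u : fixed u -> mu xi u < mu xi q -> F u = G u.
  move=> fu uq; apply: contrapT => uFG.
  by have := qmin u (conj fu uFG); rewrite /= lerN2 leNgt uq.
have [w [f [h [wq fr hE hind]]]] := index q fq.
have [f' [f'E f'_int]] := dual_restriction_integral fp fq wq.
have fE := restricts_inj fr (FE q fq).
have [wU _] := adapted_weight_matrix fq wq.
pose lam := lambda J xi q.
(* Each weight of W_q^+ is that of an edge to a lower fixed point, where [F] and [G] agree; the
   congruences along it make [F q - G q] divisible by this weight. *)
have fj0 (k : 'I_n) : (k < lam)%N -> f_ lam (f - f') k = 0.
  move=> kl; have [_ _ /(_ k)[_ /(_ kl)[wk wkxi]]] := wq.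
  have [s e sE] := set_bij_surj (weights_edges Hconv fq) wk.
  have [fs _ _ _] := e; have [m m0 mE] := edge_weightE Hconv e.
  have sq : mu xi s < mu xi q.
    by rewrite -subr_gt0 mu_diff mE dotpZr dotpC sE mulr_gt0.
  have [g gE] := Fgkm s q e.
  have [g' g'E] := dual_restriction_edge Hconv Hxi fp e.
  apply: (f_eq0 (g := g - g') wU kl).
  rewrite substB fE f'E -sE mulrBr -gE -g'E -/(G q) -/(G s) (FG s)//.
  by rewrite opprB addrA subrK.
have hB : tofrac (h - (q == p)%:R) = integral_CP lam (f - f').
  rewrite rmorphB integral_CPB /= hE f'_int; congr (_ - _).
  by case: eqP; rewrite ?rmorph1 ?rmorph0.
(* Sending w_0 to 0 turns [f_0] into [F q - G q], and turns the factor [h - (q == p)%:R] into 0 by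
   the value of the local index. *)
have /(congr1 (fun P => subst P (fun i => oapp (fun j =>
  lin (w j)) 0 (unlift ord0 i)))) :=
  integral_CP_eq0P fj0 hB.
rewrite substM substB -hind (_ : subst (q == p)%:R _ = (q == p)%:R); last first.
  by case: eqP; rewrite ?subst1 ?subst0.
rewrite subrr mul0r /f_0 subst_subst => fB; apply: qFG; apply/eqP.
rewrite -subr_eq0 /G -fE -f'E -substB -{}fB; apply/eqP/eq_subst => i.
case: ifP => _; rewrite ?substD /W0 /W !substX ?unlift_none ?liftK /=;
  by rewrite ?add0r.
Qed.

Lemma poincare_dual_restriction p tau : fixed p -> poincare_dual x J xi p tau ->
  forall q, fixed q -> restricts x tau q (dual_restriction J xi p q).
Proof.
move=> fp [_ _ tau0 tauE] q fq; rewrite /dual_restriction.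
by case: asboolP => Fq; [exact: tauE | exact: tau0].
Qed.

(** The GKM congruences provide a cocycle with the right restrictions. These being homogeneous of
    degree lambda_p, its component in twice that degree has the same ones. *)
Lemma poincare_dual_exists p : (forall j, pure 2 (x j)) -> fixed p ->
  exists eta, poincare_dual x J xi p eta.
Proof.
move=> x2 fp; have [tau ctau tauE] : exists2 tau : cochain R (MT M),
  cocycle tau &
    forall q, fixed q -> restricts x tau q (dual_restriction J xi p q).
  by apply/(restriction_image Hloc) => r q; exact: dual_restriction_edge.
exists (degree_part (lambda J xi p).*2 tau).
have etaE q : fixed q ->
    restricts x (degree_part (lambda J xi p).*2 tau) q (dual_restriction J xi p
      q).
  by move=> fq; apply: restricts_degree_part;
    [|exact: dual_restriction_homog|exact: tauE].
split=> [|||q fq Fq].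
- exact: cocycle_degree_part.
- exact: pure_degree_part.
- by move=> q fq Fq; have := etaE q fq; rewrite /dual_restriction asboolF.
- by have := etaE q fq; rewrite /dual_restriction asboolT.
Qed.

End CanonicalClasses.

Theorem proposition4p17 (R : realType) (n : nat) (M : symplectic_toric R n)
    (J : acs M) (x : 'I_n -> cochain R (BT R n)) (xi : 'rV[R]_n) (p : M)
    (HJ : compatible_acs J) (Hx : chern_classes x)
    (Hconv : convexity_theorem J) (Hloc : localization_theorem M x)
    (Hxi : generic J xi) (Hp : fixed p) :
  [/\ exists tau : cochain R (MT M), i_canonical x J xi p tau,
      exists eta : cochain R (MT M), poincare_dual x J xi p eta
    & forall tau eta : cochain R (MT M),
        i_canonical x J xi p tau -> poincare_dual x J xi p eta ->
        cohomologous tau eta].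
Proof.
have x2 j : pure 2 (x j) by case: (Hx j).
have [eta etaP] := poincare_dual_exists Hconv Hloc Hxi x2 Hp.
split; [|by exists eta|].
  (* The Poincaré dual itself serves as i-canonical class. *)
  exists eta; apply: (dual_restriction_i_canonical Hconv) => //;
    first by case: etaP.
  exact: poincare_dual_restriction.
move=> {eta etaP} tau eta tauP etaP; apply: (restriction_inj Hloc).
- by case: tauP => -[].
- by case: etaP.
move=> q fq; apply: cohomologous_trans
  (i_canonical_restriction Hconv Hloc Hxi Hp tauP fq) (cohomologous_sym _).
exact: poincare_dual_restriction.
Qed.
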